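(* Let $p\in(0,\infty)$, let $\alpha\in\mathbb R$, and let $f:\mathbb C\to\mathbb C$ be an entire function. Then the function $r\mapsto \mathsf M_{p,\alpha}(f,r)$ is strictly increasing on $(0,\infty)$ unless $f$ is constant. Consequently, for every $r\in(0,\infty)$, $$|f(0)|^p=\mathsf M_{p,\alpha}(f,0)\le \mathsf M_{p,\alpha}(f,r)\le \mathsf M_{p,\alpha}(f,\infty),$$ with equality if and only if $f$ is constant.
   Context: Let $dA$ be the Euclidean area measure on $\mathbb C$. For an entire function $f$, $p\in(0,\infty)$, $\alpha\in\mathbb R$ and $r\in(0,\infty)$, the Gaussian integral means of $f$ are $$\mathsf M_{p,\alpha}(f,r)=\frac{\int_{|z|<r}|f(z)|^pe^{-\alpha|z|^2}\,dA(z)}{\int_{|z|<r}e^{-\alpha|z|^2}\,dA(z)}.$$ Further, $\mathsf M_{p,\alpha}(f,0)=\lim_{r\to0^+}\mathsf M_{p,\alpha}(f,r)$ and $\mathsf M_{p,\alpha}(f,\infty)=\lim_{r\to\infty}\mathsf M_{p,\alpha}(f,r)\in[0,\infty]$. When $\alpha>0$ the latter equals $\left(\int_{\mathbb C}e^{-\alpha|z|^2}dA(z)\right)^{-1}\int_{\mathbb C}|f(z)|^pe^{-\alpha|z|^2}dA(z)$. *)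

(* Defs.v *)
From mathcomp Require Import all_boot all_order all_algebra.
From mathcomp Require Import all_classical all_reals all_analysis.
From mathcomp.real_closed Require Import complex.

Set Implicit Arguments.
Unset Strict Implicit.
Unset Printing Implicit Defensive.

Import Order.TTheory GRing.Theory Num.Theory.
Import numFieldNormedType.Exports.

Local Open Scope classical_set_scope.
Local Open Scope ring_scope.

(* [derivable] is taken over the field of scalars [R[i]], so this is complex
   differentiability at every point. *)
Definition entire (R : realType) (f : R[i] -> R[i]) : Prop :=
  forall z : R[i], derivable (f : R[i]^o -> R[i]^o) z 1.

(* The norm of [R[i]] takes its values in [R[i]]; this is the same modulus as an
   element of [R]. *)
Definition modulus (R : realType) (z : R[i]) : R := complex.Re `|z|.

(* [R[i]] carries no measurable structure: area integrals are taken over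
   [R * R], with [w = (x, y)] standing for [x + iy]. *)
Definition toC (R : realType) (w : R * R) : R[i] := (w.1 +i* w.2)%C.

Definition disc (R : realType) (r : R) : set (R * R) :=
  [set w | modulus (toC w) < r].

Definition area_integral (R : realType) (D : set (R * R)) (g : R[i] -> R)
    : \bar R :=
  (\int[@lebesgue_measure R \x @lebesgue_measure R]_(w in D)
     (g (toC w))%:E)%E.

Definition gaussian_mean (R : realType) (p alpha : R) (f : R[i] -> R[i])
    (r : R) : \bar R :=
  (area_integral (disc r)
     (fun z => (modulus (f z) `^ p * expR (- alpha * modulus z ^+ 2))%R)
   / area_integral (disc r) (fun z => expR (- alpha * modulus z ^+ 2)%R))%E.

Definition gaussian_mean_at0 (R : realType) (p alpha : R) (f : R[i] -> R[i])
    : \bar R :=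
  lim (gaussian_mean p alpha f r @[r --> 0^'+]).

Definition gaussian_mean_at_infty (R : realType) (p alpha : R)
    (f : R[i] -> R[i]) : \bar R :=
  lim (gaussian_mean p alpha f r @[r --> +oo%R]).

Definition constant_fun (R : realType) (f : R[i] -> R[i]) : Prop :=
  exists c : R[i], forall z : R[i], f z = c.

(* Main.v *)
Require Import Defs.
From HB Require Import structures.
From mathcomp Require Import all_boot all_order all_algebra.
From mathcomp Require Import all_classical all_reals all_analysis.
From mathcomp.real_closed Require Import complex.
From mathcomp Require Import ring lra measurable_realfun.

(** Gaussian integral means are averages of |f|^p against a radial weight, so they
    are controlled by the circle means of |f|^p. If these are nondecreasing in the
    radius, with value m at radius r1, then the weighted mean over the disc of
    radius r1 is at most m and the weighted mean over an annulus around it is at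
    least m; enlarging the disc can only raise the mean ([disc_mean_lt]). The
    reduction to circle means ([ge0_integral_circle]) needs only that area is
    invariant under rotations, which holds because a rotation is a product of
    shears, together with Tonelli's theorem.

    Monotonicity of the circle means ([circle_int_abs_pow_le]) is a maximum
    principle. Goursat's theorem ([goursat_rect]), applied to h(z + exp w) on the
    rectangles of the w-plane, gives the mean value property ([mean_value]) for a
    complex differentiable h. Applied to a local branch of log f, and combined with 1 +
      x <= exp x, it gives
    |f(z)|^p <= mean of |f|^p over small circles about z where f(z) <> 0
    ([local_submean]). Near the zeros of f the admissible radius shrinks, so |f|
    is first replaced by max(|f|, e), for which one radius serves a whole disc.
    The average of this function over rotations is radial and inherits the
    inequality; a radial function with this property has no strict interior
    maximum on a disc, hence is nondecreasing in the radius ([circle_int_le]).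
    Then e tends to 0.

    The inequality between the centre and a circle is strict for nonconstant f
    ([circle_int_abs_pow_lt]). Equality at radius r, used for the exponents p and
    p/2, says that |f|^(p/2) has variance zero on circles, so |f| = |f(0)| on the
    disc ([circle_int_eq_modulus]), and the mean value property of Re(f / f(0))
    then gives f = f(0) there ([constant_on_disc]). The identity theorem
    ([holo_eq0]) is again a consequence of monotonicity, applied to the entire
    functions (f(z) - f(0)) / z^n. *)

Set Implicit Arguments.
Unset Strict Implicit.
Unset Printing Implicit Defensive.

Import Order.TTheory GRing.Theory Num.Theory.
Import numFieldNormedType.Exports.

Local Open Scope classical_set_scope.
Local Open Scope ring_scope.

(** * Integrals of continuous functions over a segment *)

Section SegmentIntegral.
Context {R : realType}.
Implicit Types (a b m x K : R) (g h : R -> R).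
Local Notation mu := (@lebesgue_measure R).

Definition seg_int a b g : R := \int[mu]_(x in `[a, b]) g x.

(** Two-sided continuity at every point of the segment, endpoints included. *)
Definition ctn_on a b g := {in `[a, b], continuous g}.

Lemma ctn_on_integrable a b g : ctn_on a b g ->
  mu.-integrable `[a, b] (EFin \o g).
Proof.
move=> cg; apply: continuous_compact_integrable; first exact: segment_compact.
apply: continuous_in_subspaceT => x xab; apply: cg.
by move: xab; rewrite inE.
Qed.

Lemma ctn_onS a b c d g : a <= c -> d <= b -> ctn_on a b g -> ctn_on c d g.
Proof.
move=> ac db cg x; rewrite in_itv/= => /andP[cx xd]; apply: cg.
by rewrite in_itv/= (le_trans ac cx) (le_trans xd db).
Qed.

Lemma continuous_ctn_on a b g : continuous g -> ctn_on a b g.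
Proof. by move=> cg x _; exact: cg. Qed.

Lemma seg_int_eq a b g h : {in `[a, b], g =1 h} -> seg_int a b g = seg_int a b h.
Proof. by move=> gh; apply: eq_Rintegral => x; rewrite inE => /gh. Qed.

Lemma seg_int_ereal a b g : ctn_on a b g ->
  (\int[mu]_(x in `[a, b]) (g x)%:E)%E = (seg_int a b g)%:E.
Proof.
move=> cg; rewrite /seg_int /Rintegral fineK//.
by apply: integrable_fin_num => //; exact: ctn_on_integrable.
Qed.

Lemma seg_int_cst a b K : a <= b -> seg_int a b (fun=> K) = K * (b - a).
Proof.
move=> ab; rewrite /seg_int Rintegral_cst//.
change (K * fine (mu `[a, b]) = K * (b - a)); rewrite lebesgue_measure_itv/= lte_fin.
by move: ab; rewrite le_eqVlt => /predU1P[->|->//]; rewrite ltxx subrr.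
Qed.

Lemma seg_intD a b g h : ctn_on a b g -> ctn_on a b h ->
  seg_int a b (fun x => g x + h x) = seg_int a b g + seg_int a b h.
Proof. by move=> cg ch; rewrite /seg_int RintegralD//; exact: ctn_on_integrable. Qed.

Lemma seg_intB a b g h : ctn_on a b g -> ctn_on a b h ->
  seg_int a b (fun x => g x - h x) = seg_int a b g - seg_int a b h.
Proof. by move=> cg ch; rewrite /seg_int RintegralB//; exact: ctn_on_integrable. Qed.

Lemma seg_intZ a b K g : ctn_on a b g ->
  seg_int a b (fun x => K * g x) = K * seg_int a b g.
Proof. by move=> cg; rewrite /seg_int RintegralZl//; exact: ctn_on_integrable. Qed.

Lemma le_seg_int a b g h : ctn_on a b g -> ctn_on a b h ->
  {in `[a, b], forall x, g x <= h x} -> seg_int a b g <= seg_int a b h.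
Proof.
move=> cg ch gh; apply: le_Rintegral => //; try exact: ctn_on_integrable.
Qed.

Lemma seg_int_split a m b g : a <= m -> m <= b -> ctn_on a b g ->
  seg_int a b g = seg_int a m g + seg_int m b g.
Proof.
move=> am mb cg.
have := @Rintegral_itvB R g (BLeft a) (BRight b) m (ctn_on_integrable cg).
rewrite !bnd_simp => /(_ am mb) E.
apply/eqP; rewrite addrC -subr_eq; apply/eqP.
rewrite {1}/seg_int {1}/seg_int E Rintegral_itv_obnd_cbnd//.
apply: integrableS (ctn_on_integrable cg) => //.
by apply: subset_itvr; rewrite bnd_simp.
Qed.

Lemma seg_int_abs_le a b g K : a <= b -> ctn_on a b g ->
  {in `[a, b], forall x, `|g x| <= K} -> `|seg_int a b g| <= K * (b - a).
Proof.
move=> ab cg gK; rewrite ler_norml -mulNr -!seg_int_cst//.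
have cc k : ctn_on a b (fun=> k) by move=> x _; exact: cst_continuous.
by apply/andP; split; apply: le_seg_int => // x /gK; rewrite ler_norml => /andP[].
Qed.

(** A nonnegative continuous function with a positive value has positive
    integral; this is how equality in a mean value inequality becomes a
    pointwise equality. *)
Lemma seg_int_le0_eq0 a b g : a < b -> ctn_on a b g ->
  {in `[a, b], forall x, 0 <= g x} -> seg_int a b g <= 0 ->
  {in `[a, b], forall x, g x = 0}.
Proof.
move=> ab cg g0 Ig0 x xab.
move: (xab); rewrite in_itv/= => /andP[ax xb].
apply/eqP; rewrite eq_le g0// andbT leNgt; apply/negP => gx0.
have g20 : 0 < g x / 2 by rewrite divr_gt0.
have /cvgrPdist_lt/(_ _ g20) := cg _ xab.
move=> [d /= d0 dg].
set c := Num.max a (x - d / 2); set e := Num.min b (x + d / 2).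
have ac : a <= c by rewrite /c le_max lexx.
have eb : e <= b by rewrite /e ge_min lexx.
have ce : c < e.
  by rewrite /c /e gt_max !lt_min; apply/andP; split; apply/andP; split; lra.
have cge : {in `[c, e], forall y, g x / 2 <= g y}.
  move=> y; rewrite in_itv/= /c /e ge_max le_min => /andP[/andP[? ?] /andP[? ?]].
  have : ball x d y by rewrite /ball/= ltr_norml; apply/andP; split; lra.
  move=> /dg; rewrite ltr_norml => /andP[_ h].
  by move: h; rewrite ltrBlDr => h; lra.
have cce : ctn_on c e g by exact: ctn_onS cg.
have : 0 < seg_int c e g.
  apply: (@lt_le_trans _ _ (g x / 2 * (e - c))).
    by rewrite mulr_gt0// subr_gt0.
  rewrite -seg_int_cst; last exact: ltW.
  by apply: le_seg_int => // y _; exact: cst_continuous.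
suff : seg_int c e g <= seg_int a b g by move=> /le_trans/(_ Ig0) /le_lt_trans h /h;
  rewrite ltxx.
have ce' := ltW ce.
rewrite (@seg_int_split a c b)// ?(le_trans ce')//.
rewrite (@seg_int_split c e b)//; last exact: ctn_onS cg.
have p u v : a <= u -> v <= b -> 0 <= seg_int u v g.
  move=> au vb; apply: Rintegral_ge0 => y; rewrite /= in_itv/= => /andP[uy yv].
  by apply: g0; rewrite in_itv/= (le_trans au uy) (le_trans yv vb).
have := p a c (lexx a) (le_trans ce' eb); have := p e b (le_trans ac ce') (lexx b).
by lra.
Qed.

End SegmentIntegral.

(** * Borel sets and rotation invariance of area in the plane *)

Section PlaneMeasure.
Context {R : realType}.
Local Notation mu := (@lebesgue_measure R).
Local Notation mu2 := (mu \x mu)%E.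
Local Notation mR := (measurableTypeR R).

Lemma lebesgue_measure_shift (c : R) (A : set mR) : measurable A ->
  pushforward mu (fun x : mR => x + c : mR) A = mu A.
Proof.
have shiftE : forall a b : R, (fun x : mR => x + c : mR) @^-1` `]a, b]
    = `]a - c, b - c]%classic.
  move=> a b; apply/seteqP; split => x /=; rewrite !in_itv/= => /andP[? ?];
  by apply/andP; split; lra.
move=> mA; apply/esym; apply: lebesgue_measure_unique => //.
  by apply: measurable_funD; [exact: measurable_id|exact: measurable_cst].
move=> /= _ _ [[a b]] _ <-.
rewrite /pushforward/= shiftE !lebesgue_measure_itv/= !lte_fin ltrD2r.
by case: ifP => // _; congr (_%:E); ring.
Qed.

Lemma ge0_integral_shift (c : R) (F : mR -> \bar R) :
  measurable_fun setT F -> (forall x, 0 <= F x)%E ->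
  (\int[mu]_x F (x + c)%R = \int[mu]_x F x)%E.
Proof.
move=> mF F0.
have mc : measurable_fun setT (fun x : mR => x + c : mR).
  by apply: measurable_funD; [exact: measurable_id|exact: measurable_cst].
have := @ge0_integral_pushforward _ _ _ _ R _ mc mu setT F measurableT mF (fun y _ => F0 y).
rewrite preimage_setT => <-.
by apply: eq_measure_integral => A mA _; exact: lebesgue_measure_shift.
Qed.

(** An open set of the plane is the union of the rational boxes it contains,
    hence belongs to the product of the Borel sigma-algebras. *)
Lemma open_measurable_plane (U : set (R * R)) : open U ->
  measurable (U : set (mR * mR)).
Proof.
move=> oU.
pose box (q : (rat * rat) * (rat * rat)) : set (R * R) :=
  `]ratr q.1.1, ratr q.1.2[ `*` `]ratr q.2.1, ratr q.2.2[.
have -> : U = \bigcup_q (if `[< box q `<=` U >] then box q else set0).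
  apply/seteqP; split => [[x y] Uxy|[x y] [q _]]; last first.
    by case: ifPn => // /asboolP + ?; exact.
  have : nbhs (x, y) U by move: oU; rewrite openE => /(_ _ Uxy).
  move=> [[A B]] /= [/nbhs_ballP[d1 /= d10 A1] /nbhs_ballP[d2 /= d20 B2]] ABU.
  have ex (z d : R) : 0 < d -> exists q : rat * rat,
      [/\ z - d < ratr q.1, ratr q.1 < z, z < ratr q.2 & ratr q.2 < z + d].
    move=> d0.
    have /rat_in_itvoo[q1] : z - d < z by lra.
    have /rat_in_itvoo[q2] : z < z + d by lra.
    rewrite !in_itv/= => /andP[? ?] /andP[? ?].
    by exists (q1, q2).
  have [q1 [a1 a2 a3 a4]] := ex x d1 d10.
  have [q2 [b1 b2 b3 b4]] := ex y d2 d20.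
  exists (q1, q2) => //.
  case: asboolP => [_|]; first by split; rewrite /= in_itv/= ?a2 ?b2.
  case=> -[u v] [/=]; rewrite !in_itv/= => /andP[u1 u2] /andP[v1 v2].
  apply: ABU; split => /=; [apply: A1|apply: B2];
    by rewrite /ball/= ltr_norml; apply/andP; split; lra.
apply: countable_bigcupT_measurable; first exact: countableP.
move=> q; case: ifP => // _; apply: measurableX; exact: measurable_itv.
Qed.

Lemma continuous_measurable_plane (g : R * R -> R) : continuous g ->
  measurable_fun [set: mR * mR] g.
Proof.
move=> /continuousP cg; apply: (measurability _ (RGenOpens.measurableE R)).
move=> _ [_ [a [b ->] <-]]; rewrite setTI.
by apply: open_measurable_plane; exact/cg/interval_open.
Qed.

Lemma ge0_integral_shear1 (t : R) (F : mR * mR -> \bar R) :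
  measurable_fun setT F -> (forall w, 0 <= F w)%E ->
  (\int[mu2]_w F (w.1 + t * w.2, w.2)%R = \int[mu2]_w F w)%E.
Proof.
move=> mF F0.
have mS : measurable_fun setT (fun w : mR * mR => (w.1 + t * w.2, w.2) : mR * mR).
  apply: measurable_fun_pair; last exact: measurable_snd.
  apply: measurable_funD; first exact: measurable_fst.
  apply: measurable_funM; [exact: measurable_cst|exact: measurable_snd].
rewrite !fubini_tonelli2//; last exact: (measurableT_comp mF mS).
apply: eq_integral => y _; rewrite /fubini_G/=.
rewrite (@ge0_integral_shift (t * y) (fun x => F (x, y)))//.
exact: measurable_fun_pair1.
Qed.

Lemma ge0_integral_shear2 (t : R) (F : mR * mR -> \bar R) :
  measurable_fun setT F -> (forall w, 0 <= F w)%E ->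
  (\int[mu2]_w F (w.1, w.2 + t * w.1)%R = \int[mu2]_w F w)%E.
Proof.
move=> mF F0.
have mS : measurable_fun setT (fun w : mR * mR => (w.1, w.2 + t * w.1) : mR * mR).
  apply: measurable_fun_pair; first exact: measurable_fst.
  apply: measurable_funD; first exact: measurable_snd.
  apply: measurable_funM; [exact: measurable_cst|exact: measurable_fst].
rewrite !fubini_tonelli1//; last exact: (measurableT_comp mF mS).
apply: eq_integral => x _; rewrite /fubini_F/=.
rewrite (@ge0_integral_shift (t * x) (fun y => F (x, y)))//.
exact: measurable_fun_pair2.
Qed.

(** Multiplication by c + is; a rotation when c^2 + s^2 = 1. *)
Definition rotate (c s : R) (w : R * R) : R * R :=
  (c * w.1 - s * w.2, s * w.1 + c * w.2).

Lemma measurable_rotate (c s : R) :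
  measurable_fun setT (rotate c s : mR * mR -> mR * mR).
Proof.
by apply: measurable_fun_pair; [apply: measurable_funB|apply: measurable_funD];
  apply: measurable_funM; (exact: measurable_cst || exact: measurable_fst
  || exact: measurable_snd).
Qed.

(** A rotation other than the half-turn is a product of three shears, each of
    which is a translation on every line of one direction. *)
Lemma ge0_integral_rotate (c s : R) (F : mR * mR -> \bar R) :
  c ^+ 2 + s ^+ 2 = 1 -> measurable_fun setT F -> (forall w, 0 <= F w)%E ->
  (\int[mu2]_w F (rotate c s w) = \int[mu2]_w F w)%E.
Proof.
have shears c' s' (G : mR * mR -> \bar R) : 1 + c' != 0 -> c' ^+ 2 + s' ^+ 2 = 1 ->
    measurable_fun setT G -> (forall w, 0 <= G w)%E ->
    (\int[mu2]_w G (rotate c' s' w) = \int[mu2]_w G w)%E.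
  (* t is minus the tangent of half the angle of rotation. *)
  move=> c1 cs1 mG G0; pose t := - s' / (1 + c').
  rewrite -[RHS](ge0_integral_shear1 t)//.
  have mS1 : measurable_fun setT (fun w : mR * mR => (w.1 + t * w.2, w.2) : mR * mR).
    apply: measurable_fun_pair; last exact: measurable_snd.
    apply: measurable_funD; first exact: measurable_fst.
    apply: measurable_funM; [exact: measurable_cst|exact: measurable_snd].
  have mS2 : measurable_fun setT (fun w : mR * mR => (w.1, w.2 + s' * w.1) : mR * mR).
    apply: measurable_fun_pair; first exact: measurable_fst.
    apply: measurable_funD; first exact: measurable_snd.
    apply: measurable_funM; [exact: measurable_cst|exact: measurable_fst].
  have mG1 := measurableT_comp mG mS1.
  rewrite -[RHS](ge0_integral_shear2 s')//.
  have mG2 := measurableT_comp mG1 mS2.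
  rewrite -[RHS](ge0_integral_shear1 t)//.
  apply: eq_integral => -[x y] _ /=; congr (G _); rewrite /rotate/=.
  have ts : 1 + t * s' = c'.
    have -> : t * s' = (- s' ^+ 2) / (1 + c') by rewrite /t; ring.
    have -> : - s' ^+ 2 = c' ^+ 2 - 1 by rewrite -cs1; ring.
    by field.
  have tc : t * (1 + c') = - s' by rewrite /t divfK.
  congr (_, _).
    have -> : x + t * y + t * (y + s' * (x + t * y)) =
      (1 + t * s') * x + t * (1 + (1 + t * s')) * y by ring.
    by rewrite ts tc mulNr.
  have -> : y + s' * (x + t * y) = s' * x + (1 + t * s') * y by ring.
  by rewrite ts.
move=> cs1 mF F0; have [c1|] := eqVneq (1 + c) 0; last by move=> /shears; exact.
have cE : c = - 1 by apply/eqP; rewrite -subr_eq0 opprK addrC c1.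
have sE : s = 0.
  by apply/eqP; rewrite -sqrf_eq0; apply/eqP; rewrite -[RHS](subrr 1) -{1}cs1 cE; ring.
(* The half-turn is the square of the quarter-turn. *)
have quarter : (0 : R) ^+ 2 + 1 ^+ 2 = 1 by ring.
have n0 : 1 + 0 != 0 :> R by rewrite addr0 oner_neq0.
rewrite -[RHS](shears 0 1)// -[RHS](shears 0 1)//; last first.
  exact: (measurableT_comp mF (measurable_rotate 0 1)).
apply: eq_integral => -[x y] _ /=; congr (F _).
by rewrite /rotate/= cE sE; congr (_, _); ring.
Qed.

Lemma plane_measure_box (a b c d : R) : a <= b -> c <= d ->
  mu2 (`[a, b] `*` `[c, d]) = ((b - a) * (d - c))%:E.
Proof.
move=> ab cd; rewrite product_measure1E// EFinM.
have E (x y : R) : x <= y -> mu `[x, y] = (y - x)%:E.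
  move=> xy; rewrite lebesgue_measure_itv/= lte_fin.
  by case: ltgtP xy => // -> _; rewrite subrr.
by congr (_ * _)%E; exact: E.
Qed.

Lemma plane_measure_sigma_finite : sigma_finite setT mu2.
Proof.
pose F (n : nat) : set mR := `[- n%:R, n%:R]%classic.
exists (fun n => F n `*` F n).
  apply/esym/seteqP; split => // -[x y] _.
  have [n nE] : exists n : nat, Num.max `|x| `|y| <= n%:R.
    by exists (Num.truncn (Num.max `|x| `|y|)).+1; rewrite ltW// truncnS_gt.
  exists n => //; move: nE; rewrite ge_max => /andP[xn yn].
  by split; rewrite /F /= in_itv/= -ler_norml.
move=> n; split; first by apply: measurableX; exact: measurable_itv.
rewrite /F; apply: (le_lt_trans _ (ltry ((n%:R - - n%:R) * (n%:R - - n%:R)))).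
by rewrite plane_measure_box ?lexx// (le_trans _ (ler0n _ n))// oppr_le0 ler0n.
Qed.

(** Packaged for the use of Tonelli's theorem over the product of an interval
    and the plane. *)
Definition plane_measure : {sigma_finite_measure set (mR * mR)%type -> \bar R} :=
  HB.pack_for {sigma_finite_measure set (mR * mR)%type -> \bar R} mu2
    (@Measure_isSigmaFinite.Build _ _ _ mu2 plane_measure_sigma_finite).

End PlaneMeasure.

(** * Averages over rotations *)

Section CircleMean.
Context {R : realType}.
Local Notation mu := (@lebesgue_measure R).
Local Notation mu2 := (mu \x mu)%E.
Local Notation mR := (measurableTypeR R).
Implicit Types (u g : R * R -> R) (w : R * R) (a b t : R).

Definition turn t w : R * R := rotate (cos t) (sin t) w.

Lemma continuous_turn w : continuous (turn ^~ w).
Proof.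
move=> t; rewrite /turn /rotate.
apply: (@cvg_pair _ _ _ (nbhs t) (nbhs (cos t * w.1 - sin t * w.2))
  (nbhs (sin t * w.1 + cos t * w.2)) _ _ _
  (fun t => cos t * w.1 - sin t * w.2) (fun t => sin t * w.1 + cos t * w.2)).
  by apply: cvgB; apply: cvgMl; [exact: continuous_cos|exact: continuous_sin].
by apply: cvgD; apply: cvgMl; [exact: continuous_sin|exact: continuous_cos].
Qed.

(** For w at distance r from 0 this is 2 pi times the mean of u over the circle
    of radius r about 0. *)
Definition circle_int u w : R := seg_int 0 (2 * pi) (fun t => u (turn t w)).

Lemma continuous_circle u w : continuous u -> continuous (fun t => u (turn t w)).
Proof. by move=> cu t; apply: continuous_comp; [exact: continuous_turn|exact: cu]. Qed.

Lemma measurable_turn : measurable_fun setT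
  (fun tw : mR * (mR * mR) => turn tw.1 tw.2 : mR * mR).
Proof.
have mc : measurable_fun setT (fun tw : mR * (mR * mR) => cos tw.1 : mR).
  apply: (measurableT_comp _ measurable_fst).
  exact: continuous_measurable_fun (@continuous_cos R).
have ms : measurable_fun setT (fun tw : mR * (mR * mR) => sin tw.1 : mR).
  apply: (measurableT_comp _ measurable_fst).
  exact: continuous_measurable_fun (@continuous_sin R).
have m2 := @measurable_snd _ _ mR (mR * mR)%type.
have m21 := measurableT_comp measurable_fst m2.
have m22 := measurableT_comp measurable_snd m2.
by apply: measurable_fun_pair; [apply: measurable_funB|apply: measurable_funD];
  apply: measurable_funM.
Qed.

(** By rotation invariance of area each rotate of u has the same integral
    against the radial weight g as u itself; integrating over the angle and
    exchanging the integrals replaces u by its circle means. This takes the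
    place of polar coordinates. *)
Lemma ge0_integral_circle u g : continuous u -> (forall w, 0 <= u w) ->
  measurable_fun [set: mR * mR] g -> (forall w, 0 <= g w) ->
  (forall t w, g (turn t w) = g w) ->
  (\int[mu2]_w (circle_int u w * g w)%:E =
   (2 * pi)%:E * \int[mu2]_w (u w * g w)%:E)%E.
Proof.
move=> cu u0 mg g0 gturn.
pose h (tw : mR * (mR * mR)) : \bar R :=
  (\1_`[0, 2 * pi] tw.1 * (u (turn tw.1 tw.2) * g tw.2))%:E.
have mI : measurable_fun setT (\1_`[0, 2 * pi] : mR -> R) by exact: measurable_indic.
have mu_ := continuous_measurable_plane cu.
have mh : measurable_fun setT h.
  apply/measurable_EFinP; apply: measurable_funM.
    exact: (measurableT_comp mI measurable_fst).
  apply: measurable_funM; first exact: (measurableT_comp mu_ measurable_turn).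
  exact: (measurableT_comp mg measurable_snd).
have h0 tw : (0 <= h tw)%E.
  by rewrite lee_fin mulr_ge0// ?mulr_ge0// indicE; case: (_ \in _).
transitivity (\int[mu2]_w \int[mu]_t h (t, w))%E.
  apply: eq_integral => w _.
  have mc : measurable_fun setT (fun t : mR => u (turn t (w : R * R)) : mR).
    by apply: continuous_measurable_fun; exact: continuous_circle.
  rewrite EFinM -seg_int_ereal; last by apply: continuous_ctn_on; exact: continuous_circle.
  rewrite -ge0_integralZr//=; first last.
  - by rewrite lee_fin.
  - by move=> t _; rewrite lee_fin.
  - apply/measurable_EFinP; apply: measurable_funTS.
    exact: mc.
  rewrite integral_mkcond; apply: eq_integral => t _.
  rewrite /h/= indicE patchE; case: (_ \in _); first by rewrite mul1r EFinM.
  by rewrite mul0r.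
transitivity (\int[mu]_t \int[mu2]_w h (t, w))%E.
  have E := @fubini_tonelli _ _ _ _ R mu (@plane_measure R) h mh h0.
  exact: esym.
have uE t : (\int[mu2]_w (u (turn t w) * g w)%:E = \int[mu2]_w (u w * g w)%:E)%E.
  rewrite -[RHS](@ge0_integral_rotate _ (cos t) (sin t)) ?cos2Dsin2//.
  - by apply: eq_integral => w _; rewrite -/(turn t w) gturn.
  - by apply/measurable_EFinP; apply: measurable_funM.
  - by move=> w; rewrite lee_fin mulr_ge0.
transitivity (\int[mu]_t ((\1_`[0%R, (2 * pi)%R] t)%:E * \int[mu2]_w (u w * g w)%:E))%E.
  apply: eq_integral => t _; rewrite /h/= -(uE t) -ge0_integralZl//=.
  - apply/measurable_EFinP; apply: measurable_funM => //.
    by apply: (measurableT_comp mu_); exact: measurable_rotate.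
  - by move=> w _; rewrite lee_fin mulr_ge0.
rewrite ge0_integralZr//=; first last.
- by apply: integral_ge0 => w _; rewrite lee_fin mulr_ge0.
- exact/measurable_EFinP.
rewrite integral_indic// setIT; congr (_ * _)%E.
have pi2 : 0 < 2 * pi :> R by rewrite mulr_gt0// pi_gt0.
have := lebesgue_measure_itv `[0, 2 * pi : R].
by rewrite /= lte_fin pi2 => E; rewrite [LHS]E sube0.
Qed.

End CircleMean.

(** * Modulus and complex differentiability *)

Section ComplexDerivative.
Context {R : realType}.
Implicit Types (z w l m h : R[i]) (f g : R[i] -> R[i]) (e d : R).

Lemma ReB z w : complex.Re (z - w) = complex.Re z - complex.Re w.
Proof. by case: z; case: w. Qed.

Lemma ImB z w : complex.Im (z - w) = complex.Im z - complex.Im w.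
Proof. by case: z; case: w. Qed.

Lemma modulusE z : modulus z = Num.sqrt (complex.Re z ^+ 2 + complex.Im z ^+ 2).
Proof. by rewrite /modulus normc_def. Qed.

(** The bridge from the norm of R[i], whose values are complex numbers, to the
    real-valued modulus. *)
Lemma modulusC z : (modulus z)%:C%C = `|z|.
Proof. by rewrite /modulus normc_def. Qed.

Lemma modulus_ge0 z : 0 <= modulus z.
Proof. by rewrite modulusE sqrtr_ge0. Qed.

Lemma modulusM z w : modulus (z * w) = modulus z * modulus w.
Proof. by apply: complexI; rewrite rmorphM/= !modulusC normrM. Qed.

Lemma modulus0 : modulus (0 : R[i]) = 0.
Proof. by rewrite /modulus normr0. Qed.

Lemma modulus1 : modulus (1 : R[i]) = 1.
Proof. by rewrite /modulus normr1. Qed.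

Lemma modulus_eq0 z : (modulus z == 0) = (z == 0).
Proof. by rewrite -(inj_eq (@complexI R)) modulusC normr_eq0. Qed.

Lemma modulusV z : modulus z^-1 = (modulus z)^-1.
Proof. by apply: complexI; rewrite modulusC normfV -modulusC fmorphV. Qed.

Lemma modulusN z : modulus (- z) = modulus z.
Proof. by rewrite /modulus normrN. Qed.

Lemma modulusB z w : modulus (z - w) = modulus (w - z).
Proof. by rewrite -modulusN opprB. Qed.

Lemma modulusX z n : modulus (z ^+ n) = modulus z ^+ n.
Proof.
elim: n => [|n IHn]; first by rewrite !expr0 modulus1.
by rewrite !exprS modulusM IHn.
Qed.

Lemma ler_modulusD z w : modulus (z + w) <= modulus z + modulus w.
Proof. by rewrite -lecR rmorphD/= !modulusC ler_normD. Qed.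

Lemma ler_modulusB z w : modulus (z - w) <= modulus z + modulus w.
Proof. by rewrite -(modulusN w) ler_modulusD. Qed.

Lemma ler_modulus_trans z w l : modulus (z - l) <= modulus (z - w) + modulus (w - l).
Proof. by rewrite (le_trans _ (ler_modulusD _ _))// addrA subrK. Qed.

Lemma modulus_gt0 z : (0 < modulus z) = (z != 0).
Proof. by rewrite lt0r modulus_eq0 modulus_ge0 andbT. Qed.

Lemma sqr_modulus z : modulus z ^+ 2 = complex.Re z ^+ 2 + complex.Im z ^+ 2.
Proof. by rewrite modulusE sqr_sqrtr// addr_ge0// sqr_ge0. Qed.

Lemma normr_Re_le z : `|complex.Re z| <= modulus z.
Proof.
rewrite -(@ler_pXn2r _ 2)// ?nnegrE ?modulus_ge0// sqr_modulus real_normK ?num_real//.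
by rewrite lerDl sqr_ge0.
Qed.

Lemma normr_Im_le z : `|complex.Im z| <= modulus z.
Proof.
rewrite -(@ler_pXn2r _ 2)// ?nnegrE ?modulus_ge0// sqr_modulus real_normK ?num_real//.
by rewrite lerDr sqr_ge0.
Qed.

Lemma modulus_le z : modulus z <= `|complex.Re z| + `|complex.Im z|.
Proof.
rewrite -(@ler_pXn2r _ 2)// ?nnegrE ?modulus_ge0 ?addr_ge0// sqr_modulus.
by rewrite sqrrD !real_normK ?num_real// lerD2r lerDl mulrn_wge0// mulr_ge0.
Qed.

(** Complex differentiability with real tolerances and the real-valued modulus,
    so that no estimate has to be made in the partial order of R[i]. *)
Definition cderiv f z l := forall e, 0 < e -> exists2 d, 0 < d &
  forall w, modulus (w - z) < d ->
    modulus (f w - f z - l * (w - z)) <= e * modulus (w - z).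

Definition holo f z := exists l, cderiv f z l.

Lemma entire_holo f : entire f -> forall z, holo f z.
Proof.
move=> ef z; have := ef z => /cvg_ex[/= l fl].
exists l => e e0.
have eC0 : 0 < (e%:C)%C :> R[i] by rewrite ltcR.
move: fl => /cvgrPdist_le/(_ _ eC0).
case=> /= d d0 H.
have [d1 d10 dE] : exists2 d1 : R, 0 < d1 & d = (d1%:C)%C.
  by move: d0; rewrite ltcE/= => /andP[/eqP Im0 Re0]; exists (complex.Re d) => //;
    case: d Im0 {H Re0} => a b /= ->.
exists d1 => // w wz.
have [->|wz0] := eqVneq w z; first by rewrite !subrr mulr0 subrr !modulus0 mulr0.
have wz1 : w - z != 0 by rewrite subr_eq0.
have := H (w - z).
rewrite /= sub0r normrN -modulusC dE ltcR => /(_ wz wz1).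
rewrite -modulusC lecR /GRing.scale/= mulr1 subrK => Hw.
have -> : f w - f z - l * (w - z) = - (l - (w - z)^-1 * (f w - f z)) * (w - z).
  by field.
by rewrite modulusM modulusN ler_pM2r// modulus_gt0.
Qed.

Lemma cderiv_lip f z l : cderiv f z l -> exists2 d, 0 < d &
  forall w, modulus (w - z) < d -> modulus (f w - f z) <= (1 + modulus l) * modulus (w - z).
Proof.
move=> /(_ 1 ltr01)[d d0 H]; exists d => // w /H Hw.
rewrite -(subrK (l * (w - z)) (f w - f z)) (le_trans (ler_modulusD _ _))//.
by rewrite modulusM mulrDl lerD.
Qed.

Lemma holo_cont f z : holo f z -> forall e, 0 < e -> exists2 d, 0 < d &
  forall w, modulus (w - z) < d -> modulus (f w - f z) < e.
Proof.
move=> [l /cderiv_lip[d d0 H]] e e0.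
have l0 : 0 < 1 + modulus l by rewrite ltr_pwDl// modulus_ge0.
exists (Num.min d (e / (1 + modulus l))); first by rewrite lt_min d0 divr_gt0.
move=> w; rewrite lt_min => /andP[/H Hw]; rewrite ltr_pdivlMr// mulrC.
exact: le_lt_trans.
Qed.

Lemma holo_near f g z d : 0 < d -> (forall w, modulus (w - z) < d -> f w = g w) ->
  holo f z -> holo g z.
Proof.
move=> d0 fg [l fl]; exists l => e /fl[d' d'0 H].
exists (Num.min d d'); first by rewrite lt_min d0.
move=> w; rewrite lt_min => /andP[wd wd'].
by rewrite -(fg w)// -(fg z) ?subrr ?modulus0//; exact: H.
Qed.

Lemma holo_cst c z : holo (fun=> c) z.
Proof.
by exists 0 => e e0; exists 1 => // w _;
  rewrite subrr mul0r subrr modulus0 mulr_ge0// ?modulus_ge0// ltW.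
Qed.

Lemma holo_id z : holo id z.
Proof.
by exists 1 => e e0; exists 1 => // w _;
  rewrite mul1r subrr modulus0 mulr_ge0// ?modulus_ge0// ltW.
Qed.

Lemma holoB f g z : holo f z -> holo g z -> holo (fun w => f w - g w) z.
Proof.
move=> [l fl] [m gm]; exists (l - m) => e e0.
have e20 : 0 < e / 2 by rewrite divr_gt0.
have [d d0 Hf] := fl _ e20; have [d' d'0 Hg] := gm _ e20.
exists (Num.min d d'); first by rewrite lt_min d0.
move=> w; rewrite lt_min => /andP[/Hf ? /Hg ?].
have -> : f w - g w - (f z - g z) - (l - m) * (w - z) =
  f w - f z - l * (w - z) - (g w - g z - m * (w - z)) by ring.
by rewrite (le_trans (ler_modulusB _ _))// [leRHS](_ : _ =
  e / 2 * modulus (w - z) + e / 2 * modulus (w - z)) ?lerD//; field.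
Qed.

Lemma holoM f g z : holo f z -> holo g z -> holo (fun w => f w * g w) z.
Proof.
move=> hf hg; have := hf; have := hg => -[m gm] [l fl].
exists (l * g z + f z * m) => e e0.
pose A := modulus (g z) + 1; pose B := modulus (f z) + 1; pose C := modulus l + 1.
have A0 : 0 < A by rewrite ltr_wpDl// modulus_ge0.
have B0 : 0 < B by rewrite ltr_wpDl// modulus_ge0.
have C0 : 0 < C by rewrite ltr_wpDl// modulus_ge0.
have ex X : 0 < X -> 0 < e / 3 / X by move=> X0; rewrite !divr_gt0.
have [d1 d10 H1] := fl _ (ex _ A0); have [d2 d20 H2] := gm _ (ex _ B0).
have [d3 d30 H3] := holo_cont hg ltr01.
have [d4 d40 H4] := holo_cont hg (ex _ C0).
exists (Num.min (Num.min d1 d2) (Num.min d3 d4)); first by rewrite !lt_min d10 d20 d30.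
move=> w; rewrite !lt_min => /andP[/andP[/H1 h1 /H2 h2] /andP[/H3 h3 /H4 h4]].
have -> : f w * g w - f z * g z - (l * g z + f z * m) * (w - z) =
  (f w - f z - l * (w - z)) * g w + f z * (g w - g z - m * (w - z))
   + l * (w - z) * (g w - g z) by ring.
have mz0 := modulus_ge0 (w - z).
have gw : modulus (g w) <= A.
  rewrite /A -{1}(subrK (g z) (g w)) (le_trans (ler_modulusD _ _))// addrC lerD2l.
  exact: ltW.
rewrite (le_trans (ler_modulusD _ _))// !modulusM.
rewrite [leRHS](_ : _ = (e / 3 + e / 3 + e / 3) * modulus (w - z)); last by field.
rewrite [leRHS]mulrDl lerD//.
  rewrite [leRHS]mulrDl (le_trans (ler_modulusD _ _))// !modulusM lerD//.
    rewrite (le_trans (ler_pM (modulus_ge0 _) (modulus_ge0 _) h1 gw))//.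
    by rewrite mulrAC divfK// gt_eqF.
  have fB : modulus (f z) <= B by rewrite /B lerDl.
  rewrite (le_trans (ler_pM (modulus_ge0 _) (modulus_ge0 _) fB h2))//.
  by rewrite mulrA mulrCA mulfV ?gt_eqF// mulr1.
have lC : modulus l <= C by rewrite /C lerDl.
rewrite mulrAC ler_wpM2r// (le_trans (ler_pM (modulus_ge0 _) (modulus_ge0 _) lC
  (ltW h4)))//.
by rewrite mulrCA mulfV ?gt_eqF// mulr1.
Qed.

Lemma holo_comp f g z : holo f z -> holo g (f z) -> holo (g \o f) z.
Proof.
move=> hf [m gm]; have := hf => -[l fl]; exists (m * l) => e e0.
have [d1 d10 H1] := cderiv_lip fl.
pose K := 1 + modulus l; have K0 : 0 < K by rewrite ltr_pwDl// modulus_ge0.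
pose M := 1 + modulus m; have M0 : 0 < M by rewrite ltr_pwDl// modulus_ge0.
have eK : 0 < e / 2 / K by rewrite !divr_gt0.
have eM : 0 < e / 2 / M by rewrite !divr_gt0.
have [d2 d20 H2] := gm _ eK; have [d3 d30 H3] := fl _ eM.
have [d4 d40 H4] := holo_cont hf d20.
exists (Num.min d1 (Num.min d3 d4)); first by rewrite !lt_min d10 d30.
move=> w; rewrite !lt_min => /and3P[/H1 h1 /H3 h3 /H4/H2 h2] /=.
have -> : g (f w) - g (f z) - m * l * (w - z) =
  g (f w) - g (f z) - m * (f w - f z) + m * (f w - f z - l * (w - z)) by ring.
rewrite (le_trans (ler_modulusD _ _))// modulusM.
rewrite [leRHS](_ : _ = (e / 2 + e / 2) * modulus (w - z)); last by field.
rewrite [leRHS]mulrDl lerD//.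
  rewrite (le_trans h2)// (le_trans (ler_wpM2l (ltW eK) h1))//.
  by rewrite mulrA divfK// gt_eqF.
have mM : modulus m <= M by rewrite /M lerDr.
rewrite (le_trans (ler_pM (modulus_ge0 _) (modulus_ge0 _) mM h3))//.
by rewrite mulrA mulrCA mulfV ?gt_eqF// mulr1.
Qed.

Lemma holoV z : z != 0 -> holo (fun w => w^-1) z.
Proof.
move=> z0; exists (- (z ^+ 2)^-1) => e e0.
have mz : 0 < modulus z by rewrite modulus_gt0.
exists (Num.min (modulus z / 2) (e * modulus z ^+ 3 / 2)).
  by rewrite lt_min !divr_gt0// mulr_gt0// exprn_gt0.
move=> w; rewrite lt_min => /andP[w1 w2].
have mw : modulus z / 2 <= modulus w.
  have := ler_modulus_trans 0 w z; rewrite !sub0r !modulusN => h; lra.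
have w0 : w != 0 by rewrite -modulus_gt0 (lt_le_trans _ mw)// divr_gt0.
have -> : w^-1 - z^-1 - - (z ^+ 2)^-1 * (w - z) = (w - z) ^+ 2 / (z ^+ 2 * w).
  by field; rewrite w0.
have mw0 : 0 < modulus w by rewrite modulus_gt0.
rewrite modulusM modulusV modulusM !modulusX ler_pdivrMr ?mulr_gt0 ?exprn_gt0//.
rewrite expr2 -mulrA [leRHS]mulrCA ler_wpM2l ?modulus_ge0//.
rewrite (le_trans (ltW w2))// [leLHS](_ : _ = e * (modulus z ^+ 2 * (modulus z / 2)));
  last by field.
by rewrite ler_pM2l// ler_pM2l// exprn_gt0.
Qed.

End ComplexDerivative.

(** * Exponential and logarithm *)

Section ExpLog.
Context {R : realType}.
Implicit Types (z w : R[i]) (e d x y : R).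

Definition cexp z : R[i] :=
  (expR (complex.Re z) * cos (complex.Im z) +i* (expR (complex.Re z) * sin
    (complex.Im z)))%C.

(** The principal logarithm on the right half-plane, the only place where the
    arctangent is the argument. *)
Definition clog z : R[i] := (ln (modulus z) +i* atan (complex.Im z / complex.Re z))%C.

Lemma cexpD z w : cexp (z + w) = cexp z * cexp w.
Proof.
case: z => a b; case: w => c d; rewrite /cexp/=.
apply/eqP; rewrite eq_complex/= expRD cosD sinD; apply/andP.
by split; apply/eqP; ring.
Qed.

Lemma modulus_cexp z : modulus (cexp z) = expR (complex.Re z).
Proof.
apply/eqP; rewrite -(@eqrXn2 _ 2)// ?modulus_ge0 ?expR_ge0// sqr_modulus/= !exprMn -mulrDr.
by rewrite cos2Dsin2 mulr1.
Qed.

Lemma is_derive_eps (g : R -> R) x l : is_derive x 1 g l ->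
  forall e, 0 < e -> exists2 d, 0 < d &
    forall y, `|y - x| < d -> `|g y - g x - l * (y - x)| <= e * `|y - x|.
Proof.
move=> [dg gl] e e0.
have := dg => /cvg_ex[/= k gk].
have kl : k = l by rewrite -gl; apply/esym/cvg_lim.
move: gk; rewrite kl => /cvgrPdist_le/(_ _ e0)[d /= d0 H].
exists d => // y yx.
have [->|yx0] := eqVneq y x; first by rewrite !subrr mulr0 subrr !normr0 mulr0.
have yx1 : y - x != 0 by rewrite subr_eq0.
have := H (y - x); rewrite /= sub0r normrN => /(_ yx yx1).
rewrite /GRing.scale/= mulr1 subrK => Hy.
have -> : g y - g x - l * (y - x) = - (l - (y - x)^-1 * (g y - g x)) * (y - x).
  by field.
by rewrite normrM normrN ler_pM2r// normr_gt0.
Qed.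

Lemma cexp_near0 e : 0 < e -> exists2 d, 0 < d &
  forall w, modulus w < d -> modulus (cexp w - 1 - w) <= e * modulus w.
Proof.
move=> e0.
have dexp : is_derive (0 : R) 1 expR 1 by rewrite -{2}(@expR0 R); exact: is_derive_expR.
have dcos : is_derive (0 : R) 1 cos 0 by rewrite -{2}oppr0 -{2}(@sin0 R);
  exact: is_derive_cos.
have dsin : is_derive (0 : R) 1 sin 1 by rewrite -{2}(@cos0 R); exact: is_derive_sin.
(* The errors of the two components add up to at most 6 k |w|. *)
pose k := Num.min (e / 10) 1.
have k0 : 0 < k by rewrite lt_min divr_gt0// ltr01.
have [d1 d10 H1] := is_derive_eps dexp k0.
have [d2 d20 H2] := is_derive_eps dcos k0.
have [d3 d30 H3] := is_derive_eps dsin k0.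
exists (Num.min (Num.min d1 d2) (Num.min d3 (k / 2))).
  by rewrite !lt_min d10 d20 d30 divr_gt0.
case=> x y; rewrite !lt_min => /andP[/andP[m1 m2] /andP[m3 m4]].
have xw := normr_Re_le (x +i* y)%C; have yw := normr_Im_le (x +i* y)%C.
rewrite /= in xw yw.
have := H1 x; rewrite subr0 expR0 mul1r => /(_ (le_lt_trans xw m1)) h1.
have := H2 y; rewrite subr0 cos0 mul0r subr0 => /(_ (le_lt_trans yw m2)) h2.
have := H3 y; rewrite subr0 sin0 subr0 mul1r => /(_ (le_lt_trans yw m3)) h3.
rewrite (le_trans (modulus_le _))// /cexp /= subr0.
have ke : 10 * k <= e by rewrite mulrC -ler_pdivlMr// ge_min lexx.
have k1 : k <= 1 by rewrite ge_min lexx orbT.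
move: xw yw m4 h1 h2 h3; set m := modulus _ => xw yw m4 h1 h2 h3.
have m0 : 0 <= m by rewrite modulus_ge0.
have ex1 : `|expR x - 1| <= k.
  have -> : expR x - 1 = (expR x - 1 - x) + x by ring.
  rewrite (le_trans (ler_normD _ _))//.
  have : k * `|x| <= 1 * `|x| by rewrite ler_wpM2r.
  lra.
have ex2 : `|expR x| <= 2.
  by have := ler_normD (expR x - 1) 1; rewrite subrK normr1; lra.
have cy : `|cos y - 1| <= k * m by rewrite (le_trans h2)// ler_wpM2l// ltW.
have sy : `|sin y - y| <= k * m by rewrite (le_trans h3)// ler_wpM2l// ltW.
have exm : `|expR x - 1 - x| <= k * m by rewrite (le_trans h1)// ler_wpM2l// ltW.
have -> : expR x * cos y - 1 - x = expR x * (cos y - 1) + (expR x - 1 - x) by ring.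
have -> : expR x * sin y - y = expR x * (sin y - y) + (expR x - 1) * y by ring.
have b1 := le_trans (ler_normD (expR x * (cos y - 1)) (expR x - 1 - x)) (lexx _).
have b2 := le_trans (ler_normD (expR x * (sin y - y)) ((expR x - 1) * y)) (lexx _).
rewrite !normrM in b1 b2.
have c1 : `|expR x| * `|cos y - 1| <= 2 * (k * m) by rewrite ler_pM.
have c2 : `|expR x| * `|sin y - y| <= 2 * (k * m) by rewrite ler_pM.
have c3 : `|expR x - 1| * `|y| <= k * m by rewrite ler_pM.
have := ler_wpM2r m0 ke; have := mulr_ge0 (ltW k0) m0.
lra.
Qed.

Lemma cderiv_cexp z : cderiv cexp z (cexp z).
Proof.
move=> e e0.
have mz : 0 < modulus (cexp z) by rewrite modulus_cexp expR_gt0.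
have [d d0 H] := cexp_near0 (divr_gt0 e0 mz).
exists d => // w /H h.
have -> : cexp w = cexp z * cexp (w - z) by rewrite -cexpD addrC subrK.
have -> : cexp z * cexp (w - z) - cexp z - cexp z * (w - z) =
  cexp z * (cexp (w - z) - 1 - (w - z)) by ring.
by rewrite modulusM mulrC -ler_pdivlMr// mulrAC.
Qed.

Lemma holo_cexp z : holo cexp z.
Proof. by exists (cexp z); exact: cderiv_cexp. Qed.

Lemma clogK z : 0 < complex.Re z -> cexp (clog z) = z.
Proof.
case: z => a b /= a0; rewrite /cexp /clog/=.
have m0 : 0 < modulus (a +i* b)%C.
  by rewrite modulus_gt0 eq_complex/= gt_eqF.
rewrite lnK ?posrE//.
have c0 : cos (atan (b / a)) != 0
  by rewrite cos_atan invr_eq0 gt_eqF// sqrtr_gt0 ltr_pwDl// sqr_ge0.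
have sE : sin (atan (b / a)) = b / a * cos (atan (b / a)).
  by rewrite -[X in _ = X * _]atanK /tan divfK.
have cE : modulus (a +i* b)%C * cos (atan (b / a)) = a.
  rewrite cos_atan modulusE/=.
  have -> : a ^+ 2 + b ^+ 2 = a ^+ 2 * (1 + (b / a) ^+ 2) by field; rewrite gt_eqF.
  rewrite sqrtrM ?sqr_ge0// sqrtr_sqr gtr0_norm// mulfK// gt_eqF// sqrtr_gt0.
  by rewrite ltr_pwDl// sqr_ge0.
by rewrite sE mulrCA cE divfK ?gt_eqF.
Qed.

Lemma plane_cont (G : R * R -> R) z : {for (complex.Re z, complex.Im z), continuous G} ->
  forall e, 0 < e -> exists2 d, 0 < d & forall w, modulus (w - z) < d ->
    `|G (complex.Re w, complex.Im w) - G (complex.Re z, complex.Im z)| < e.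
Proof.
move=> cG e e0; have /cvgrPdist_lt/(_ _ e0) := cG.
move=> [[A B]] /= [/nbhs_ballP[d1 /= d10 A1] /nbhs_ballP[d2 /= d20 B2]] AB.
exists (Num.min d1 d2); first by rewrite lt_min d10.
move=> w; rewrite lt_min => /andP[w1 w2]; rewrite distrC.
apply: (AB (complex.Re w, complex.Im w)); split => /=; [apply: A1|apply: B2];
  rewrite /ball/= distrC.
  by rewrite -ReB (le_lt_trans (normr_Re_le _)).
by rewrite -ImB (le_lt_trans (normr_Im_le _)).
Qed.

Lemma continuous_modulus_pair : continuous (fun w : R * R => modulus (w.1 +i* w.2)%C).
Proof.
move=> w; under eq_fun do rewrite modulusE/=.
apply: (@continuous_comp _ _ _ (fun w : R * R => w.1 ^+ 2 + w.2 ^+ 2));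
  last exact: sqrt_continuous.
by apply: cvgD; apply: cvgM; (exact: cvg_fst || exact: cvg_snd).
Qed.

Lemma clog_cont z : 0 < complex.Re z -> forall e, 0 < e -> exists2 d, 0 < d &
  forall w, modulus (w - z) < d -> modulus (clog w - clog z) < e.
Proof.
move=> z0 e e0; have e20 : 0 < e / 2 by rewrite divr_gt0.
have mz : 0 < modulus z by rewrite modulus_gt0; apply: contraTneq z0 => ->; rewrite ltxx.
have c1 : {for (complex.Re z, complex.Im z),
    continuous (fun w : R * R => ln (modulus (w.1 +i* w.2)%C))}.
  apply: continuous_comp; first exact: continuous_modulus_pair.
  by apply: continuous_ln; case: z z0 mz.
have c2 : {for (complex.Re z, complex.Im z), continuous (fun w : R * R =>
  atan (w.2 / w.1))}.
  apply: continuous_comp; last exact: continuous_atan.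
  by apply: cvgM; [exact: cvg_snd|apply: cvgV; [rewrite gt_eqF|exact: cvg_fst]].
have [d1 d10 H1] := plane_cont c1 e20.
have [d2 d20 H2] := plane_cont c2 e20.
exists (Num.min d1 d2); first by rewrite lt_min d10.
move=> w; rewrite lt_min => /andP[/H1 h1 /H2 h2].
rewrite (le_lt_trans (modulus_le _))// (splitr e) /clog ltrD//=.
by case: w h1 {h2}; case: z {z0 mz c1 c2 H1 H2}.
Qed.

(** The logarithm is differentiated as the continuous inverse of the
    exponential. *)
Lemma holo_clog z : 0 < complex.Re z -> holo clog z.
Proof.
move=> z0.
have mz : 0 < modulus z by rewrite modulus_gt0; apply: contraTneq z0 => ->; rewrite ltxx.
exists z^-1 => e e0.
pose k := Num.min (modulus z / 2) (e * modulus z ^+ 2 / 2).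
have k0 : 0 < k by rewrite lt_min !divr_gt0// mulr_gt0// exprn_gt0.
have [d1 d10 H1] := cderiv_cexp (clog z) k0.
have [d2 d20 H2] := clog_cont z0 d10.
exists (Num.min d2 (complex.Re z)); first by rewrite lt_min d20.
move=> w; rewrite lt_min => /andP[/H2/H1 h w2].
have w0 : 0 < complex.Re w.
  have := le_lt_trans (normr_Re_le _) w2.
  by rewrite ReB ltr_norml => /andP[]; lra.
move: h; rewrite !clogK//; set D := clog w - clog z => h.
have km : k <= modulus z / 2 by rewrite ge_min lexx.
have ke : k <= e * modulus z ^+ 2 / 2 by rewrite ge_min lexx orbT.
have D0 := modulus_ge0 D.
(* The error bound for the exponential first bounds the increment of the
   logarithm by the increment of its argument. *)
have Dle : modulus D <= 2 / modulus z * modulus (w - z).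
  rewrite -ler_pdivrMl ?divr_gt0// invf_div.
  have := ler_modulus_trans (z * D) (w - z) 0.
  rewrite !subr0 modulusM (modulusB (z * D)).
  move=> t; have := ler_wpM2r D0 km; lra.
have -> : D - z^-1 * (w - z) = - (z^-1 * (w - z - z * D)).
  by field; rewrite -modulus_gt0.
rewrite modulusN modulusM modulusV mulrC ler_pdivrMr// (le_trans h)//.
apply: (le_trans (ler_wpM2r D0 ke)).
have m2 : 0 <= e * modulus z ^+ 2 / 2 by rewrite (le_trans _ ke)// ltW.
apply: (le_trans (ler_wpM2l m2 Dle)).
by rewrite le_eqVlt; apply/orP; left; apply/eqP; field; rewrite gt_eqF.
Qed.

End ExpLog.

(** * Goursat's theorem for rectangles *)

Section Goursat.
Context {R : realType}.
Implicit Types (H : R[i] -> R[i]) (x y a b m e d : R).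

(** The imaginary part of the contour integral of H(z) dz around the boundary of
    the rectangle, with opposite sides paired. *)
Definition rect_int H x1 x2 y1 y2 : R :=
  seg_int x1 x2 (fun x => complex.Im (H (x +i* y1)%C) - complex.Im (H (x +i* y2)%C)) +
  seg_int y1 y2 (fun y => complex.Re (H (x2 +i* y)%C) - complex.Re (H (x1 +i* y)%C)).

Definition holo_rect H x1 x2 y1 y2 := forall x y,
  x1 <= x <= x2 -> y1 <= y <= y2 -> holo H (x +i* y)%C.

Lemma holo_cont_hor H x y : holo H (x +i* y)%C ->
  {for x, continuous (fun t => complex.Re (H (t +i* y)%C))} /\
  {for x, continuous (fun t => complex.Im (H (t +i* y)%C))}.
Proof.
move=> /holo_cont hH.
split; apply/cvgrPdist_lt => e /hH[d d0 Hd]; exists d => // t /= xt;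
  rewrite distrC -?ReB -?ImB;
  (apply: (le_lt_trans (normr_Re_le _)) || apply: (le_lt_trans (normr_Im_le _)));
  apply: Hd; rewrite (le_lt_trans (modulus_le _))//= subrr normr0 addr0 distrC //.
Qed.

Lemma holo_cont_ver H x y : holo H (x +i* y)%C ->
  {for y, continuous (fun t => complex.Re (H (x +i* t)%C))} /\
  {for y, continuous (fun t => complex.Im (H (x +i* t)%C))}.
Proof.
move=> /holo_cont hH.
split; apply/cvgrPdist_lt => e /hH[d d0 Hd]; exists d => // t /= xt;
  rewrite distrC -?ReB -?ImB;
  (apply: (le_lt_trans (normr_Re_le _)) || apply: (le_lt_trans (normr_Im_le _)));
  apply: Hd; rewrite (le_lt_trans (modulus_le _))//= subrr normr0 add0r distrC //.
Qed.

Lemma holo_rect_ctn_hor H x1 x2 y1 y2 y : holo_rect H x1 x2 y1 y2 -> y1 <= y <= y2 ->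
  ctn_on x1 x2 (fun t => complex.Re (H (t +i* y)%C)) /\
  ctn_on x1 x2 (fun t => complex.Im (H (t +i* y)%C)).
Proof.
by move=> hH yy; split=> x; rewrite in_itv/= => xx; have [] := holo_cont_hor (hH x y xx yy).
Qed.

Lemma holo_rect_ctn_ver H x1 x2 y1 y2 x : holo_rect H x1 x2 y1 y2 -> x1 <= x <= x2 ->
  ctn_on y1 y2 (fun t => complex.Re (H (x +i* t)%C)) /\
  ctn_on y1 y2 (fun t => complex.Im (H (x +i* t)%C)).
Proof.
by move=> hH xx; split=> y; rewrite in_itv/= => yy; have [] := holo_cont_ver (hH x y xx yy).
Qed.

Lemma ctn_onB a b (g h : R -> R) : ctn_on a b g -> ctn_on a b h ->
  ctn_on a b (fun x => g x - h x).
Proof. by move=> cg ch x xab; apply: cvgB; [exact: cg|exact: ch]. Qed.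

Lemma holo_rectS H x1 x2 y1 y2 a b c d : x1 <= a -> b <= x2 -> y1 <= c -> d <= y2 ->
  holo_rect H x1 x2 y1 y2 -> holo_rect H a b c d.
Proof.
move=> xa bx yc dy hH x y /andP[? ?] /andP[? ?]; apply: hH; apply/andP; split; lra.
Qed.

Lemma rect_int_split_x H x1 m x2 y1 y2 : x1 <= m -> m <= x2 -> y1 <= y2 ->
  holo_rect H x1 x2 y1 y2 ->
  rect_int H x1 x2 y1 y2 = rect_int H x1 m y1 y2 + rect_int H m x2 y1 y2.
Proof.
move=> xm mx yy hH; rewrite /rect_int.
have y1i : y1 <= y1 <= y2 by rewrite lexx.
have y2i : y1 <= y2 <= y2 by rewrite lexx andbT.
have [_ ch1] := holo_rect_ctn_hor hH y1i; have [_ ch2] := holo_rect_ctn_hor hH y2i.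
rewrite (seg_int_split xm mx); last exact: ctn_onB.
have xx := le_trans xm mx.
have [cx1 _] := @holo_rect_ctn_ver H x1 x2 y1 y2 x1 hH (introT andP (conj (lexx x1) xx)).
have [cx2 _] := @holo_rect_ctn_ver H x1 x2 y1 y2 x2 hH (introT andP (conj xx (lexx x2))).
have [cm _] := @holo_rect_ctn_ver H x1 x2 y1 y2 m hH (introT andP (conj xm mx)).
by rewrite !(@seg_intB _ y1 y2)//; ring.
Qed.

Lemma rect_int_split_y H x1 x2 y1 m y2 : x1 <= x2 -> y1 <= m -> m <= y2 ->
  holo_rect H x1 x2 y1 y2 ->
  rect_int H x1 x2 y1 y2 = rect_int H x1 x2 y1 m + rect_int H x1 x2 m y2.
Proof.
move=> xx ym my hH; rewrite /rect_int.
have x1i : x1 <= x1 <= x2 by rewrite lexx.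
have x2i : x1 <= x2 <= x2 by rewrite lexx andbT.
have [ch1 _] := holo_rect_ctn_ver hH x1i; have [ch2 _] := holo_rect_ctn_ver hH x2i.
rewrite (seg_int_split ym my); last exact: ctn_onB.
have yy := le_trans ym my.
have [_ cy1] := @holo_rect_ctn_hor H x1 x2 y1 y2 y1 hH (introT andP (conj (lexx y1) yy)).
have [_ cy2] := @holo_rect_ctn_hor H x1 x2 y1 y2 y2 hH (introT andP (conj yy (lexx y2))).
have [_ cm] := @holo_rect_ctn_hor H x1 x2 y1 y2 m hH (introT andP (conj ym my)).
by rewrite !(@seg_intB _ x1 x2)//; ring.
Qed.

(** An affine function contributes nothing to the contour integral, so only the
    remainder of the first-order expansion counts. *)
Lemma rect_int_local H x0 y0 : holo H (x0 +i* y0)%C ->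
  forall e, 0 < e -> exists2 d, 0 < d & forall x1 x2 y1 y2,
    x1 <= x0 <= x2 -> y1 <= y0 <= y2 -> (x2 - x1) + (y2 - y1) < d ->
    holo_rect H x1 x2 y1 y2 ->
    `|rect_int H x1 x2 y1 y2| <= e * ((x2 - x1) + (y2 - y1)) ^+ 2.
Proof.
move=> [l Hl] e e0; have e20 : 0 < e / 2 by rewrite divr_gt0.
have [d d0 Hd] := Hl _ e20; exists d => // x1 x2 y1 y2 /andP[x10 x02] /andP[y10 y02].
set p := x2 - x1 + (y2 - y1) => pd hH.
have xx := le_trans x10 x02; have yy := le_trans y10 y02.
pose E x y := H (x +i* y)%C - H (x0 +i* y0)%C - l * ((x - x0) +i* (y - y0))%C.
have Ep x y : x1 <= x <= x2 -> y1 <= y <= y2 -> modulus (E x y) <= e / 2 * p.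
  move=> /andP[? ?] /andP[? ?].
  have mp : modulus ((x - x0) +i* (y - y0))%C <= p.
    rewrite (le_trans (modulus_le _))//= lerD// ler_norml; apply/andP; split; lra.
  have -> : E x y = H (x +i* y)%C - H (x0 +i* y0)%C - l * ((x +i* y)%C -
    (x0 +i* y0)%C) by [].
  rewrite (le_trans (Hd _ _))//; last by rewrite ler_wpM2l// ltW.
  exact: le_lt_trans mp pd.
case: l Hl Hd @E Ep => l1 l2 Hl Hd E Ep.
have ReH x y : complex.Re (H (x +i* y)%C) = complex.Re (H (x0 +i* y0)%C)
    + (l1 * (x - x0) - l2 * (y - y0)) + complex.Re (E x y).
  by rewrite /E !ReB/=; ring.
have ImH x y : complex.Im (H (x +i* y)%C) = complex.Im (H (x0 +i* y0)%C)
    + (l1 * (y - y0) + l2 * (x - x0)) + complex.Im (E x y).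
  by rewrite /E !ImB/=; ring.
have y1i : y1 <= y1 <= y2 by rewrite lexx.
have y2i : y1 <= y2 <= y2 by rewrite lexx andbT.
have x1i : x1 <= x1 <= x2 by rewrite lexx.
have x2i : x1 <= x2 <= x2 by rewrite lexx andbT.
have [_ ch1] := holo_rect_ctn_hor hH y1i; have [_ ch2] := holo_rect_ctn_hor hH y2i.
have [cv1 _] := holo_rect_ctn_ver hH x1i; have [cv2 _] := holo_rect_ctn_ver hH x2i.
pose g x := (complex.Im (H (x +i* y1)%C) - complex.Im (H (x +i* y2)%C)) - - (l1 *
  (y2 - y1)).
pose h y := (complex.Re (H (x2 +i* y)%C) - complex.Re (H (x1 +i* y)%C)) - l1 * (x2 - x1).
have cc a b k : ctn_on a b (fun=> k : R) by move=> ? _; exact: cst_continuous.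
have cg : ctn_on x1 x2 g by apply: ctn_onB => //; exact: ctn_onB.
have ch : ctn_on y1 y2 h by apply: ctn_onB => //; exact: ctn_onB.
have Ig : `|seg_int x1 x2 g| <= e * p * (x2 - x1).
  apply: seg_int_abs_le => // x; rewrite in_itv/= => xi.
  have -> : g x = complex.Im (E x y1) - complex.Im (E x y2)
    by rewrite /g (ImH x y1) (ImH x y2); ring.
  have := le_trans (normr_Im_le _) (Ep _ _ xi y1i);
    have := le_trans (normr_Im_le _) (Ep _ _ xi y2i).
  have := ler_normB (complex.Im (E x y1)) (complex.Im (E x y2)); lra.
have Ih : `|seg_int y1 y2 h| <= e * p * (y2 - y1).
  apply: seg_int_abs_le => // y; rewrite in_itv/= => yi.
  have -> : h y = complex.Re (E x2 y) - complex.Re (E x1 y)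
    by rewrite /h (ReH x1 y) (ReH x2 y); ring.
  have := le_trans (normr_Re_le _) (Ep _ _ x1i yi);
    have := le_trans (normr_Re_le _) (Ep _ _ x2i yi).
  have := ler_normB (complex.Re (E x2 y)) (complex.Re (E x1 y)); lra.
have -> : rect_int H x1 x2 y1 y2 = seg_int x1 x2 g + seg_int y1 y2 h.
  rewrite (@seg_intB _ x1 x2 _ (fun=> - (l1 * (y2 - y1)))); [|exact: ctn_onB|exact: cc].
  rewrite (@seg_intB _ y1 y2 _ (fun=> l1 * (x2 - x1))); [|exact: ctn_onB|exact: cc].
  by rewrite !seg_int_cst// /rect_int; ring.
rewrite (le_trans (ler_normD _ _))// (le_trans (lerD Ig Ih))//.
by rewrite -mulrDr -mulrA expr2.
Qed.

(** The contour integral is the sum of those over the four quarters, so one of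
    them carries at least a quarter of its absolute value. *)
Lemma rect_int_quarter H x a y b K : 0 <= a -> 0 <= b ->
  holo_rect H x (x + 2 * a) y (y + 2 * b) ->
  4 * K <= `|rect_int H x (x + 2 * a) y (y + 2 * b)| ->
  exists x' y', [/\ x <= x', x' + a <= x + 2 * a, y <= y', y' + b <= y + 2 * b &
    K <= `|rect_int H x' (x' + a) y' (y' + b)|].
Proof.
move=> a0 b0 hH Q.
have xa : x + 2 * a = x + a + a by ring.
have yb : y + 2 * b = y + b + b by ring.
have E : rect_int H x (x + 2 * a) y (y + 2 * b) =
    rect_int H x (x + a) y (y + b) + rect_int H x (x + a) (y + b) (y + b + b) +
   (rect_int H (x + a) (x + a + a) y (y + b) +
    rect_int H (x + a) (x + a + a) (y + b) (y + b + b)).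
  rewrite (@rect_int_split_x H x (x + a))//; try lra.
  rewrite (@rect_int_split_y H x (x + a) y (y + b)); try lra.
    rewrite (@rect_int_split_y H (x + a) (x + 2 * a) y (y + b)); try lra.
      by rewrite xa yb.
    by apply: holo_rectS hH; lra.
  by apply: holo_rectS hH; lra.
apply: contrapT => nex.
have small x' y' : x <= x' -> x' + a <= x + 2 * a -> y <= y' -> y' + b <= y + 2 * b ->
    `|rect_int H x' (x' + a) y' (y' + b)| < K.
  by move=> *; rewrite ltNge; apply/negP => Kle; apply: nex; exists x', y'.
have s1 := small x y ltac:(lra) ltac:(lra) ltac:(lra) ltac:(lra).
have s2 := small x (y + b) ltac:(lra) ltac:(lra) ltac:(lra) ltac:(lra).
have s3 := small (x + a) y ltac:(lra) ltac:(lra) ltac:(lra) ltac:(lra).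
have s4 := small (x + a) (y + b) ltac:(lra) ltac:(lra) ltac:(lra) ltac:(lra).
move: Q s1 s2 s3 s4; rewrite E; move: (rect_int _ _ _ _ _) (rect_int _ _ _ _ _)
  (rect_int _ _ _ _ _) (rect_int _ _ _ _ _) => q4 q3 q2 q1 Q s1 s2 s3 s4.
have := ler_normD (q1 + q2) (q3 + q4); have := ler_normD q1 q2; have := ler_normD q3 q4.
lra.
Qed.

Lemma nested_limit (s : nat -> R) a : 0 <= a ->
  (forall n, s n <= s n.+1 /\ s n.+1 + a / 2 ^+ n.+1 <= s n + a / 2 ^+ n) ->
  exists t, forall n, s n <= t <= s n + a / 2 ^+ n.
Proof.
move=> a0 sP.
have an n : 0 <= a / 2 ^+ n by rewrite divr_ge0// exprn_ge0.
have mono n k : s n <= s (n + k)%N /\ s (n + k)%N + a / 2 ^+ (n + k) <= s n + a / 2 ^+ n.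
  elim: k => [|k [IH1 IH2]]; first by rewrite addn0.
  have [h1 h2] := sP (n + k)%N; rewrite addnS; split; first exact: le_trans IH1 h1.
  exact: le_trans h2 IH2.
have cross n k : s k <= s n + a / 2 ^+ n.
  have [/subnKC <-|/ltnW/subnKC <-] := leqP n k.
    have [_] := mono n (k - n)%N; apply: le_trans; by rewrite lerDl.
  by have [h _] := mono k (n - k)%N; rewrite (le_trans h)// lerDl.
have ubs n : ubound (range s) (s n + a / 2 ^+ n) by move=> _ [k _ <-].
have ne : range s !=set0 by exists (s 0%N), 0%N.
exists (sup (range s)) => n; apply/andP; split.
  by apply: ub_le_sup; [exists (s 0%N + a / 2 ^+ 0); exact: ubs|exists n].
exact: ge_sup.
Qed.

(** Goursat's bisection. Repeated quartering keeps the contour integral at least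
    K / 4^n over rectangles of perimeter proportional to 2^-n, against the bound
    o(4^-n) that differentiability at their common point gives. *)
Theorem goursat_rect H x1 x2 y1 y2 : x1 <= x2 -> y1 <= y2 ->
  holo_rect H x1 x2 y1 y2 -> rect_int H x1 x2 y1 y2 = 0.
Proof.
move=> xx yy hH; apply/eqP; rewrite -normr_le0 leNgt; apply/negP.
set K := `|_| => K0.
pose a := x2 - x1; pose b := y2 - y1.
have a0 : 0 <= a by rewrite subr_ge0.
have b0 : 0 <= b by rewrite subr_ge0.
pose P n (c : R * R) := [/\ x1 <= c.1, c.1 + a / 2 ^+ n <= x2, y1 <=
  c.2, c.2 + b / 2 ^+ n <= y2 &
  K / 4 ^+ n <= `|rect_int H c.1 (c.1 + a / 2 ^+ n) c.2 (c.2 + b / 2 ^+ n)|].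
pose S n (c c' : R * R) := [/\ c.1 <= c'.1, c'.1 + a / 2 ^+ n.+1 <= c.1 + a / 2 ^+ n,
  c.2 <= c'.2 & c'.2 + b / 2 ^+ n.+1 <= c.2 + b / 2 ^+ n].
have half (c : R) n : c / 2 ^+ n = 2 * (c / 2 ^+ n.+1).
  by rewrite exprS; field; rewrite expf_neq0.
have step (nc : nat * (R * R)) : exists c', P nc.1 nc.2 -> P nc.1.+1 c' /\ S nc.1 nc.2 c'.
  case: nc => n [x y] /=; have [|nP] := pselect (P n (x, y)); last by exists 0 => /nP.
  rewrite /P/= => -[p1 p2 p3 p4 p5].
  rewrite half (half b) in p5.
  have := @rect_int_quarter H x (a / 2 ^+ n.+1) y (b / 2 ^+ n.+1) (K / 4 ^+ n.+1).
  rewrite -!half => /(_ _ _ _ _)[||||x' [y' [q1 q2 q3 q4 q5]]].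
  - by rewrite divr_ge0// exprn_ge0.
  - by rewrite divr_ge0// exprn_ge0.
  - by apply: holo_rectS hH.
  - by move: p5; rewrite -!half; apply: le_trans; rewrite exprS le_eqVlt; apply/orP;
    left; apply/eqP; field; rewrite expf_neq0.
  exists (x', y') => _; split; split => //=.
  - exact: le_trans q1.
  - exact: le_trans p2.
  - exact: le_trans q3.
  - exact: le_trans p4.
have [g gP] := choice step.
pose s := fix s n := if n is n'.+1 then g (n', s n') else (x1, y1).
have sP n : P n (s n).
  elim: n => [|n IH]; last by have [] := gP (n, s n) IH.
  rewrite /P/= !expr0 !divr1 /a /b !(addrC _ (_ - _)) !subrK.
  by split.
have sS n : S n (s n) (s n.+1) by have [] := gP (n, s n) (sP n).
have [x0 x0P] : exists t, forall n, (s n).1 <= t <= (s n).1 + a / 2 ^+ n.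
  by apply: (@nested_limit (fun n => (s n).1)) => // n; have [] := sS n.
have [y0 y0P] : exists t, forall n, (s n).2 <= t <= (s n).2 + b / 2 ^+ n.
  by apply: (@nested_limit (fun n => (s n).2)) => // n; have [] := sS n.
have h0 : holo H (x0 +i* y0)%C.
  by apply: hH; [have := x0P 0%N|have := y0P 0%N]; rewrite /= expr0 divr1 addrC subrK.
pose p := a + b.
have p0 : 0 <= p by rewrite addr_ge0.
(* Chosen so that e * p^2 < K. *)
pose e := K / (p ^+ 2 + 1).
have pp : 0 < p ^+ 2 + 1 by rewrite ltr_wpDl// sqr_ge0.
have e0 : 0 < e by rewrite divr_gt0.
have [d d0 Hd] := rect_int_local h0 e0.
have [n nd] : exists n : nat, p / 2 ^+ n < d.
  exists (Num.truncn (p / d)).+1; rewrite ltr_pdivrMr ?exprn_gt0// mulrC -ltr_pdivrMr//.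
  rewrite (lt_le_trans (truncnS_gt _))// -natrX ler_nat ltnW// ltn_expl//.
have [p1 p2 p3 p4 p5] := sP n.
have := Hd _ _ _ _ (x0P n) (y0P n).
rewrite !(addrC _ (_ / _)) !addrK -mulrDl -/p => /(_ nd).
rewrite !(addrC (_ / _)) => /(_ (holo_rectS p1 p2 p3 p4 hH)) /(le_trans p5).
rewrite leNgt => /negP; apply.
rewrite exprMn exprVn -exprM mulnC exprM ltr_pdivlMr ?exprn_gt0//.
have -> : 2 ^+ 2 = 4 :> R by ring.
rewrite mulrA divfK ?expf_neq0// /e mulrAC ltr_pdivrMr// mulrDr mulr1 ltrDl//.
Qed.

End Goursat.

(** * The mean value property and its consequence for |f|^p *)

Section MeanValue.
Context {R : realType}.
Implicit Types (f h : R[i] -> R[i]) (z w : R[i]) (e d r p : R).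

Definition polar z r t : R[i] := z + (r * cos t +i* (r * sin t))%C.

Lemma modulus_polarB z r t : 0 <= r -> modulus (polar z r t - z) = r.
Proof.
move=> r0; rewrite /polar addrC addKr modulusE/= !exprMn -mulrDr cos2Dsin2 mulr1.
by rewrite sqrtr_sqr ger0_norm.
Qed.

Lemma polar_cexp z x y : z + cexp (x +i* y)%C = polar z (expR x) y.
Proof. by []. Qed.

Lemma cos2pi : cos (2 * pi : R) = 1.
Proof. by rewrite mulr_natl mulr2n cosD cospi sinpi; ring. Qed.

Lemma sin2pi : sin (2 * pi : R) = 0.
Proof. by rewrite mulr_natl mulr2n sinD sinpi; ring. Qed.

Lemma pi2_gt0 : 0 < 2 * pi :> R.
Proof. by rewrite mulr_gt0// pi_gt0. Qed.

Lemma holoD f h z : holo f z -> holo h z -> holo (fun w => f w + h w) z.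
Proof.
move=> hf hh; have := holoB hf (holoB (holo_cst 0 z) hh).
by apply: (@holo_near _ _ _ _ 1) => // w _; rewrite sub0r opprK.
Qed.

Lemma continuous_polar_Re h z r : 0 <= r ->
  (forall w, modulus (w - z) <= r -> holo h w) ->
  continuous (fun t => complex.Re (h (polar z r t))).
Proof.
move=> r0 hh t.
apply/cvgrPdist_lt => e e0.
have ht : holo h (polar z r t) by apply: hh; rewrite modulus_polarB.
have [d d0 Hd] := holo_cont ht e0.
have d20 : 0 < d / 2 by rewrite divr_gt0.
have cc : {for t, continuous (fun t => r * cos t)} by apply: cvgMr; exact: continuous_cos.
have cs : {for t, continuous (fun t => r * sin t)} by apply: cvgMr; exact: continuous_sin.
have /cvgrPdist_lt/(_ _ d20) Nc := cc; have /cvgrPdist_lt/(_ _ d20) Ns := cs.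
near=> s; rewrite distrC -ReB (le_lt_trans (normr_Re_le _))//.
apply: Hd; rewrite /polar opprD addrACA subrr add0r (le_lt_trans (modulus_le _))//=.
rewrite (splitr d) ltrD// distrC; near: s; [exact: Nc|exact: Ns].
Unshelve. all: by end_near. Qed.

(** In the coordinate s + it of z + exp(s + it) circles about z become vertical
    segments and the two horizontal sides of the contour cancel by periodicity,
    so circle means of Re h do not depend on the radius; letting s tend to
    minus infinity gives the value at the centre. *)
Lemma mean_value h z d r : 0 < r -> r < d ->
  (forall w, modulus (w - z) < d -> holo h w) ->
  seg_int 0 (2 * pi) (fun t => complex.Re (h (polar z r t))) = 2 * pi * complex.Re (h z).
Proof.
move=> r0 rd hh.
pose H w := h (z + cexp w).
have holoH x y : expR x < d -> holo H (x +i* y)%C.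
  move=> xd; apply: (@holo_comp _ (fun w => z + cexp w) h).
    by apply: holoD; [exact: holo_cst|exact: holo_cexp].
  by apply: hh; rewrite addrC addKr modulus_cexp.
pose J s := seg_int 0 (2 * pi) (fun t => complex.Re (h (polar z (expR s) t))).
have ctnJ s : expR s < d ->
  ctn_on 0 (2 * pi) (fun t => complex.Re (h (polar z (expR s) t))).
  move=> sd; apply: continuous_ctn_on; apply: continuous_polar_Re; first exact: expR_ge0.
  by move=> w wz; apply: hh; exact: le_lt_trans sd.
have Jcst s1 s2 : s1 <= s2 -> expR s2 < d -> J s1 = J s2.
  move=> s12 s2d.
  have hR : holo_rect H s1 s2 0 (2 * pi).
    by move=> x y /andP[_ xs] _; apply: holoH; rewrite (le_lt_trans _ s2d)// ler_expR.
  have := goursat_rect s12 (ltW pi2_gt0) hR.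
  rewrite /rect_int (_ : seg_int s1 s2 _ = 0); last first.
    rewrite (_ : (fun x => _) = fun=> 0); first by rewrite seg_int_cst// mul0r.
    apply/funext => x; rewrite /H !polar_cexp /polar.
    by rewrite cos0 sin0 cos2pi sin2pi subrr.
  rewrite add0r seg_intB; [|exact: ctnJ|apply: ctnJ;
    rewrite (le_lt_trans _ s2d)// ler_expR//].
  by move/eqP; rewrite subr_eq0 => /eqP; exact: esym.
have rE : expR (ln r) = r by rewrite lnK// posrE.
have -> : seg_int 0 (2 * pi) (fun t => complex.Re (h (polar z r t))) = J (ln r)
  by rewrite /J rE.
have close e : 0 < e -> `|J (ln r) - 2 * pi * complex.Re (h z)| <= e * (2 * pi).
  move=> e0.
  have hz : holo h z by apply: hh; rewrite subrr modulus0 (lt_trans r0).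
  have [d' d'0 Hd] := holo_cont hz e0.
  pose s := Num.min (ln r) (ln (d' / 2)).
  have sr : s <= ln r by rewrite ge_min lexx.
  have sd : expR s < d' .
    apply: (@le_lt_trans _ _ (d' / 2)); last lra.
    by rewrite -(@lnK _ (d' / 2)) ?posrE ?divr_gt0// ler_expR ge_min lexx orbT.
  rewrite -(Jcst _ _ sr); last by rewrite rE.
  have cJ : ctn_on 0 (2 * pi) (fun t => complex.Re (h (polar z (expR s) t))).
    by apply: ctnJ; rewrite (le_lt_trans _ rd)// -rE ler_expR.
  have cc : ctn_on 0 (2 * pi) (fun=> complex.Re (h z)) by move=> ? _; exact: cst_continuous.
  rewrite (mulrC (2 * pi)) -[X in _ * X](subr0 (2 * pi)) -seg_int_cst ?(ltW pi2_gt0)//.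
  rewrite -seg_intB// -[X in e * X](subr0 (2 * pi)); apply: seg_int_abs_le;
    first exact: ltW pi2_gt0.
    exact: ctn_onB.
  move=> t _; rewrite -ReB (le_trans (normr_Re_le _))// ltW// Hd//.
  by rewrite modulus_polarB ?expR_ge0.
apply/eqP; rewrite -subr_eq0 -normr_le0; apply/ler_addgt0Pr => e e0; rewrite add0r.
have pi20 := pi2_gt0.
by rewrite (le_trans (close _ (divr_gt0 e0 pi20)))// divfK// gt_eqF.
Qed.

Lemma continuous_powR_ge0 (T : topologicalType) (G : T -> R) p : 0 < p ->
  (forall t, 0 <= G t) -> continuous G -> continuous (fun t => G t `^ p).
Proof.
move=> p0 G0 cG t.
have [Gt0|Gt0] := eqVneq (G t) 0; last first.
  have Gt : 0 < G t by rewrite lt0r Gt0 G0.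
  apply: (@cvg_trans _ (expR (p * ln (G s)) @[s --> t])); last first.
    rewrite /powR (negbTE Gt0); apply: continuous_comp; last exact: continuous_expR.
    by apply: cvgMr; apply: continuous_comp; [exact: cG|exact: continuous_ln].
  apply: near_eq_cvg; near=> s.
  have Gs : 0 < G s by near: s; exact: (cvgr_gt (G t) (cG t)).
  by rewrite /powR gt_eqF.
rewrite /continuous_at Gt0 powR0 ?gt_eqF//; apply/cvgrPdist_lt => e e0.
have ep : 0 < e `^ p^-1 by rewrite powR_gt0.
near=> s; rewrite sub0r normrN ger0_norm ?powR_ge0//.
rewrite -[ltRHS](powRr1 (ltW e0)) -(@mulVf _ p) ?gt_eqF// powRrM.
apply: gt0_ltr_powR => //; rewrite ?nnegrE ?powR_ge0 ?G0//.
near: s; apply: (cvgr_lt (G t) (cG t)); by rewrite Gt0.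
Unshelve. all: by end_near. Qed.

(** Near a point where f does not vanish, ln|f| is the real part of a branch of
    log f, hence equal to its circle means; the inequality for |f|^p follows
    from 1 + x <= exp x. *)
Lemma local_submean f z d r p : 0 < p -> 0 < r -> r < d ->
  (forall w, modulus (w - z) < d -> holo f w) ->
  (forall w, modulus (w - z) < d -> modulus (f w - f z) < modulus (f z)) ->
  ctn_on 0 (2 * pi) (fun t => modulus (f (polar z r t)) `^ p) ->
  2 * pi * modulus (f z) `^ p <=
    seg_int 0 (2 * pi) (fun t => modulus (f (polar z r t)) `^ p).
Proof.
move=> p0 r0 rd hf near_fz ctnf.
have fz0 : 0 < modulus (f z).
  by have := near_fz z; rewrite !subrr modulus0; apply; exact: lt_trans rd.
have fzN0 : f z != 0 by rewrite -modulus_gt0.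
(* The quotient stays within distance 1 of 1, where the principal logarithm is
   a branch of the logarithm. *)
pose g w := f w * (f z)^-1.
have g1 w : modulus (w - z) < d -> modulus (g w - 1) < 1.
  move=> /near_fz; rewrite /g -(mulfV fzN0) -mulrBl modulusM modulusV.
  by rewrite ltr_pdivrMr// mul1r.
have Reg w : modulus (w - z) < d -> 0 < complex.Re (g w).
  move=> /g1; move/(le_lt_trans (normr_Re_le _)); rewrite ReB/= ltr_norml => /andP[]; lra.
have hg w : modulus (w - z) < d -> holo g w.
  by move=> wd; apply: holoM; [exact: hf|exact: holo_cst].
have hlog w : modulus (w - z) < d -> holo (fun w => clog (g w)) w.
  by move=> wd; apply: (@holo_comp _ g (@clog R)); [exact: hg|apply: holo_clog; exact: Reg].
have M := mean_value r0 rd hlog.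
have gz : modulus (g z) = 1 by rewrite /g mulfV// modulus1.
rewrite /clog/= gz ln1 mulr0 in M.
have fE t : modulus (f (polar z r t)) `^ p =
    modulus (f z) `^ p * expR (p * ln (modulus (g (polar z r t)))).
  have pd : modulus (polar z r t - z) < d by rewrite modulus_polarB// ltW.
  have gp : 0 < modulus (g (polar z r t)).
    by rewrite modulus_gt0; apply: contraTneq (Reg _ pd) => ->; rewrite ltxx.
  have -> : f (polar z r t) = f z * g (polar z r t) by rewrite /g mulrC divfK.
  by rewrite modulusM powRM ?modulus_ge0//; congr (_ * _); rewrite /powR gt_eqF.
have cl : ctn_on 0 (2 * pi) (fun t => ln (modulus (g (polar z r t)))).
  apply: continuous_ctn_on.
  apply: (@continuous_polar_Re (fun w => clog (g w))); first exact: ltW.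
  by move=> w wr; apply: hlog; exact: le_lt_trans rd.
have c0 k : ctn_on 0 (2 * pi) (fun=> k : R) by move=> ? _; exact: cst_continuous.
have cpl : ctn_on 0 (2 * pi) (fun t => p * ln (modulus (g (polar z r t)))).
  by move=> t tI; apply: cvgMr; exact: cl.
have cpl1 : ctn_on 0 (2 * pi) (fun t => 1 + p * ln (modulus (g (polar z r t)))).
  by move=> t tI; apply: cvgD; [exact: cvg_cst|exact: cpl].
have cplA : ctn_on 0 (2 * pi) (fun t =>
  modulus (f z) `^ p * (1 + p * ln (modulus (g (polar z r t))))).
  by move=> t tI; apply: cvgMr; exact: cpl1.
have -> : 2 * pi * modulus (f z) `^ p = seg_int 0 (2 * pi)
    (fun t => modulus (f z) `^ p * (1 + p * ln (modulus (g (polar z r t))))).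
  rewrite seg_intZ// seg_intD// seg_int_cst ?(ltW pi2_gt0)// seg_intZ// M mulr0 addr0
    subr0 mul1r.
  by rewrite mulrC.
apply: le_seg_int => // t _; rewrite fE ler_wpM2l ?powR_ge0//.
exact: expR_ge1Dx.
Qed.

End MeanValue.

(** * A maximum principle for circle means *)

Section RadialMean.
Context {R : realType}.
Local Notation mu := (@lebesgue_measure R).
Local Notation mR := (measurableTypeR R).
Implicit Types (u k : R * R -> R) (c w : R * R) (a b r t s x y : R).

Lemma continuous_pairing (T : topologicalType) (g h : T -> R) :
  continuous g -> continuous h -> continuous (fun z : T => (g z, h z) : R * R).
Proof.
move=> cg ch z; apply: (@cvg_pair _ _ _ (nbhs z) (nbhs (g z)) (nbhs (h z)) _ _ _ g h).
  exact: cg.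
exact: ch.
Qed.

Lemma continuous_comp_all (S T U : topologicalType) (g : S -> T) (h : T -> U) :
  continuous g -> continuous h -> continuous (fun z => h (g z)).
Proof. by move=> cg ch z; apply: continuous_comp; [exact: cg|exact: ch]. Qed.

Lemma continuous_id (T : topologicalType) : continuous (fun z : T => z).
Proof. by move=> z; exact: cvg_id. Qed.

Lemma continuous_sec1 k y : continuous k -> continuous (fun x => k (x, y)).
Proof.
apply: continuous_comp_all; apply: continuous_pairing; first exact: continuous_id.
by move=> x; exact: cvg_cst.
Qed.

Lemma continuous_sec2 k x : continuous k -> continuous (fun y => k (x, y)).
Proof.
apply: continuous_comp_all; apply: continuous_pairing; last exact: continuous_id.
by move=> y; exact: cvg_cst.
Qed.

Lemma continuous_seg_int k a b : a <= b -> continuous k ->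
  continuous (fun x => seg_int a b (fun y => k (x, y))).
Proof.
move=> ab ck x.
have [K HK] : exists K, forall x' y, x' \in `[x - 1, x + 1] -> y \in `[a, b] ->
  `|k (x', y)| <= K.
  pose A : set (R * R) := `[x - 1, x + 1] `*` `[a, b].
  have cA : compact A by apply: compact_setX; exact: segment_compact.
  have A0 : A !=set0.
    by exists (x, a); split; rewrite /= in_itv/= ?lexx ?ab//; apply/andP; split; lra.
  have cn : {within A, continuous (fun w => `|k w|)}.
    by apply: continuous_subspaceT; apply: continuous_comp_all ck _; exact: norm_continuous.
  have [w _ Hw] := compact_EVT_max A0 cA cn.
  by exists `|k w| => x' y x'I yI; apply: Hw; rewrite inE.
have xI : x \in (`]x - 1, x + 1[%classic : set R) by rewrite inE/= in_itv/=; apply/andP;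
  split; lra.
have memI x' : `]x - 1, x + 1[%classic x' -> x' \in `[x - 1, x + 1].
  by rewrite /= !in_itv/= => /andP[? ?]; rewrite !ltW.
apply: (@continuity_under_integral R _ _ mu (fun x y => k (x, y)) `[a, b]
  (measurable_itv _) (x - 1) (x + 1) _ _ (fun=> K) _ _ x xI).
- move=> x' _; apply: ctn_on_integrable; apply: continuous_ctn_on; exact: continuous_sec2.
- by apply: aeW => y _ x' _; exact: continuous_sec1.
- by apply: ctn_on_integrable => ? _; exact: cst_continuous.
- by move=> x' /memI x'I; apply: aeW => y yI; exact: HK.
Qed.

Lemma seg_int_swap k a b : a <= b -> continuous k -> (forall w, 0 <= k w) ->
  seg_int a b (fun x => seg_int a b (fun y => k (x, y))) =
  seg_int a b (fun y => seg_int a b (fun x => k (x, y))).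
Proof.
move=> ab ck k0.
pose k' w := k (w.2, w.1).
have ck' : continuous k'.
  by apply: continuous_comp_all ck; apply: continuous_pairing => w;
    [exact: cvg_snd|exact: cvg_fst].
apply: EFin_inj; rewrite -!seg_int_ereal; first last.
- by apply: continuous_ctn_on; exact: continuous_seg_int.
- by apply: continuous_ctn_on; exact: (continuous_seg_int ab ck').
have mI : measurable_fun setT (\1_`[a, b] : mR -> R) by exact: measurable_indic.
pose h (w : mR * mR) : \bar R := (\1_`[a, b] w.1 * (\1_`[a, b] w.2 * k w))%:E.
have mh : measurable_fun setT h.
  apply/measurable_EFinP; apply: measurable_funM.
    exact: (measurableT_comp mI measurable_fst).
  apply: measurable_funM; last exact: continuous_measurable_plane.
  exact: (measurableT_comp mI measurable_snd).
have h0 w : (0 <= h w)%E by rewrite lee_fin !mulr_ge0.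
have E (g : R -> R -> R) : (forall x, continuous (g x)) -> (forall x y, 0 <= g x y) ->
    (\int[mu]_(x in `[a, b]) (seg_int a b (g x))%:E =
     \int[mu]_x \int[mu]_y (\1_`[a, b] x * (\1_`[a, b] y * g x y))%:E)%E.
  move=> cg g0; rewrite integral_mkcond; apply: eq_integral => x _.
  rewrite patchE; case: ifPn => xI; rewrite indicE ?xI ?(negbTE xI); last first.
    by rewrite integral0_eq// => y _; rewrite mul0r.
  rewrite -seg_int_ereal; last exact: continuous_ctn_on.
  rewrite integral_mkcond; apply: eq_integral => y _.
  rewrite patchE indicE; case: ifPn => yI; first by rewrite !mul1r.
  by rewrite mul0r mulr0.
rewrite (E (fun x y => k (x, y)) (fun x => @continuous_sec2 k x ck) (fun x y => k0 (x, y))).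
rewrite (E (fun y x => k (x, y)) (fun y => @continuous_sec1 k y ck) (fun y x => k0 (x, y))).
have := @fubini_tonelli _ _ _ _ R mu mu h mh h0; rewrite /h/= => ->.
by apply: eq_integral => y _; apply: eq_integral => x _; rewrite mulrCA.
Qed.

Lemma seg_int_shift (g : R -> R) a b t : continuous g -> (forall x, 0 <= g x) ->
  seg_int a b (fun x => g (x + t)) = seg_int (a + t) (b + t) g.
Proof.
move=> cg g0.
have ca : continuous (fun x => g (x + t)).
  by apply: continuous_comp_all cg => x; apply: cvgD; [exact: cvg_id|exact: cvg_cst].
apply: EFin_inj; rewrite -!seg_int_ereal; try exact: continuous_ctn_on.
rewrite integral_mkcond [RHS]integral_mkcond.
pose G (x : mR) : \bar R := ((EFin \o g) \_ `[a + t, b + t]) x.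
have mG : measurable_fun setT G.
  apply/(measurable_restrictT _ _).1 => //; apply/measurable_EFinP.
  by apply: measurable_funTS; exact: continuous_measurable_fun.
have G0 x : (0 <= G x)%E by rewrite /G patchE; case: ifP => // _; rewrite /= lee_fin.
rewrite -[RHS](ge0_integral_shift t mG G0).
apply: eq_integral => x _; rewrite /G !patchE.
have -> // : (x \in (`[a, b]%classic : set R)) =
  (x + t \in (`[a + t, b + t]%classic : set R)).
by apply/idP/idP; rewrite !inE/= !in_itv/= !lerD2r.
Qed.

(** Shifting a periodic function by a fraction of its period only permutes two
    subintervals. *)
Lemma seg_int_periodic (g : R -> R) T t : 0 <= t -> t <= T ->
  continuous g -> (forall x, 0 <= g x) -> (forall x, g (x + T) = g x) ->
  seg_int 0 T (fun x => g (x + t)) = seg_int 0 T g.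
Proof.
move=> t0 tT cg g0 gT; rewrite seg_int_shift// add0r.
have TT : T <= T + t by rewrite lerDl.
rewrite (seg_int_split tT TT); last exact: continuous_ctn_on.
rewrite (seg_int_split t0 tT); last exact: continuous_ctn_on.
rewrite addrC; congr (_ + _).
have := seg_int_shift 0 t T cg g0; rewrite add0r addrC => <-.
by apply: seg_int_eq => x _; exact: gT.
Qed.

Definition circle_pt c r t : R * R := (c.1 + r * cos t, c.2 + r * sin t).

Lemma turn_circle_pt c r s t : turn t (circle_pt c r s) = circle_pt (turn t c) r (s + t).
Proof.
by rewrite /turn /rotate /circle_pt/= cosD sinD; congr (_, _); ring.
Qed.

Lemma turnD s t w : turn s (turn t w) = turn (s + t) w.
Proof. by rewrite /turn /rotate/= cosD sinD; congr (_, _); ring. Qed.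

Lemma turn2pi t w : turn (t + 2 * pi) w = turn t w.
Proof. by rewrite /turn cosD sinD cos2pi sin2pi !mulr0 !mulr1 subr0 addr0. Qed.

Lemma circle_pt2pi c r t : circle_pt c r (t + 2 * pi) = circle_pt c r t.
Proof. by rewrite /circle_pt cosD sinD cos2pi sin2pi !mulr0 !mulr1 subr0 addr0. Qed.

Lemma continuous_circle_pt c r : continuous (circle_pt c r).
Proof.
by apply: continuous_pairing => t; apply: cvgD; (try exact: cvg_cst);
  apply: cvgMr; [exact: continuous_cos|exact: continuous_sin].
Qed.

Lemma modulus_turn t w : modulus (toC (turn t w)) = modulus (toC w).
Proof.
rewrite !modulusE/=; congr (Num.sqrt _).
have -> : (cos t * w.1 - sin t * w.2) ^+ 2 + (sin t * w.1 + cos t * w.2) ^+ 2 =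
   (cos t ^+ 2 + sin t ^+ 2) * (w.1 ^+ 2 + w.2 ^+ 2) by ring.
by rewrite cos2Dsin2 mul1r.
Qed.

Lemma turn_radius w : exists2 t, 0 <= t <= 2 * pi & w = turn t (modulus (toC w), 0).
Proof.
have [w0|w0] := eqVneq (modulus (toC w)) 0.
  exists 0; first by rewrite lexx (ltW pi2_gt0).
  move: (w0) => /eqP; rewrite modulus_eq0 eq_complex/= => /andP[/eqP a0 /eqP b0].
  by rewrite w0 /turn /rotate/= !mulr0 subr0 addr0; case: w a0 b0 {w0} => x y /= -> ->.
set m := modulus _ in w0 *; have m0 : 0 < m by rewrite lt0r w0 modulus_ge0.
have mE : m ^+ 2 = w.1 ^+ 2 + w.2 ^+ 2 by rewrite sqr_modulus.
pose c := w.1 / m.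
have c1 : -1 <= c <= 1.
  by rewrite -ler_norml normrM normfV (gtr0_norm m0) ler_pdivrMr// mul1r;
    exact: normr_Re_le (toC w).
have sE : sin (acos c) = `|w.2| / m.
  rewrite sin_acos// -[in RHS](gtr0_norm m0) -normfV -normrM -sqrtr_sqr; congr (Num.sqrt _).
  have -> : 1 - c ^+ 2 = (m ^+ 2 - w.1 ^+ 2) / m ^+ 2 by rewrite /c; field.
  by rewrite [X in X - _]mE; field.
have cE : cos (acos c) = w.1 / m by rewrite acosK// in_itv.
have a0 : 0 <= acos c by exact: acos_ge0.
have api : acos c <= pi by exact: acos_lepi.
have pi0 := pi_gt0 R.
have [y0|y0] := leP 0 w.2.
  exists (acos c); first by apply/andP; split; lra.
  rewrite /turn /rotate/= !mulr0 subr0 addr0 cE sE ger0_norm// !divfK//.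
  by case: w {w0 m m0 mE c c1 sE cE a0 api y0}.
exists (2 * pi - acos c); first by apply/andP; split; lra.
rewrite /turn /rotate/= !mulr0 subr0 addr0 cosB sinB cos2pi sin2pi !mul0r !mul1r addr0
  sub0r.
by rewrite cE sE ltr0_norm// (mulNr w.2) opprK !divfK//;
  case: w {w0 m m0 mE c c1 sE cE a0 api y0}.
Qed.

(** Rotating w shifts the angle in the circle integral. *)
Lemma circle_int_radial u w : continuous u -> (forall w, 0 <= u w) ->
  circle_int u w = circle_int u (modulus (toC w), 0).
Proof.
move=> cu u0; have [t /andP[t0 t2] wE] := turn_radius w.
rewrite /circle_int {1}wE.
under seg_int_eq do rewrite turnD.
rewrite (@seg_int_periodic (fun s => u (turn s (modulus (toC w), 0))) (2 * pi) t)//.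
- exact: continuous_circle.
- by move=> s; rewrite turn2pi.
Qed.

Lemma continuous_circle_int u : continuous u -> continuous (fun t => circle_int u (t, 0)).
Proof.
move=> cu; rewrite /circle_int.
apply: (@continuous_seg_int (fun w => u (turn w.2 (w.1, 0)))); first exact: ltW pi2_gt0.
apply: continuous_comp_all cu; rewrite /turn /rotate/=.
apply: continuous_pairing => w; [apply: cvgB|apply: cvgD]; apply: cvgM; try exact: cvg_cst;
  try exact: cvg_fst; (apply: continuous_comp; first exact: cvg_snd);
  (exact: continuous_cos || exact: continuous_sin).
Qed.

Lemma seg_int_cos : seg_int 0 (2 * pi) (@cos R) = 0.
Proof.
have := @mean_value R id 0 2 1 ltr01 ltac:(lra) (fun (w : R[i]) _ => holo_id w).
rewrite [X in _ = X -> _]mulr0 => E; rewrite -[RHS]E; apply: seg_int_eq => t _.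
by rewrite /polar/= add0r mul1r.
Qed.

(** The factor 2 pi avoids dividing; the point of the definition is that the
    radius d serves all centres of the disc at once. *)
Definition locally_submean rho u := exists2 d, 0 < d &
  forall w r, modulus (toC w) <= rho -> 0 < r -> r < d ->
    2 * pi * u w <= seg_int 0 (2 * pi) (fun s => u (circle_pt w r s)).

(** Averaging over rotations preserves the sub-mean-value property: the two
    angular integrals are exchanged, and a rotate of a circle about w is a circle
    of the same radius about the rotate of w. *)
Lemma circle_int_submean u t r : continuous u -> (forall w, 0 <= u w) ->
  (forall w, modulus (toC w) = t ->
    2 * pi * u w <= seg_int 0 (2 * pi) (fun s => u (circle_pt w r s))) ->
  0 <= t ->
  2 * pi * circle_int u (t, 0) <=
  seg_int 0 (2 * pi) (fun s => circle_int u (modulus (toC (circle_pt (t, 0) r s)), 0)).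
Proof.
move=> cu u0 sub t0.
pose k w := u (turn w.2 (circle_pt (t, 0) r w.1)).
have ck : continuous k.
  apply: continuous_comp_all cu.
  rewrite (_ : (fun w : R * R => _) =
    (fun w => circle_pt (turn w.2 (t, 0)) r (w.1 + w.2))); last first.
    by apply/funext => w; rewrite turn_circle_pt.
  rewrite /circle_pt /turn /rotate/=.
  have c1 : continuous (fun w : R * R => w.1) by move=> w; exact: cvg_fst.
  have c2 : continuous (fun w : R * R => w.2) by move=> w; exact: cvg_snd.
  have c12 : continuous (fun w : R * R => w.1 + w.2) by move=> w; apply: cvgD;
    [exact: c1|exact: c2].
  have cc1 := continuous_comp_all c2 (@continuous_cos R).
  have cs1 := continuous_comp_all c2 (@continuous_sin R).
  have cc2 := continuous_comp_all c12 (@continuous_cos R).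
  have cs2 := continuous_comp_all c12 (@continuous_sin R).
  apply: continuous_pairing => w; apply: cvgD.
  - by apply: cvgB; apply: cvgM; try exact: cvg_cst; [exact: cc1|exact: cs1].
  - by apply: cvgMr; exact: cc2.
  - by apply: cvgD; apply: cvgM; try exact: cvg_cst; [exact: cs1|exact: cc1].
  - by apply: cvgMr; exact: cs2.
have -> : seg_int 0 (2 * pi) (fun s =>
  circle_int u (modulus (toC (circle_pt (t, 0) r s)), 0)) =
    seg_int 0 (2 * pi) (fun s => seg_int 0 (2 * pi) (fun a => k (s, a))).
  by apply: seg_int_eq => s _; rewrite -circle_int_radial.
rewrite (seg_int_swap (ltW pi2_gt0) ck); last by move=> w; exact: u0.
have cswap : continuous (fun a => seg_int 0 (2 * pi) (fun s => k (s, a))).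
  apply: (@continuous_seg_int (fun w => k (w.2, w.1))); first exact: ltW pi2_gt0.
  by apply: continuous_comp_all ck; apply: continuous_pairing => w;
    [exact: cvg_snd|exact: cvg_fst].
rewrite /circle_int -seg_intZ; last by apply: continuous_ctn_on; exact: continuous_circle.
apply: le_seg_int; [|exact: continuous_ctn_on|].
  by move=> a _; apply: cvgMr; exact: continuous_circle.
move=> a; rewrite in_itv/= => /andP[a0 a2].
have := sub (turn a (t, 0)).
have mt : modulus (toC (turn a (t, 0))) = t.
  by rewrite modulus_turn modulusE/= expr0n/= addr0 sqrtr_sqr ger0_norm.
move=> /(_ mt) /le_trans; apply; rewrite le_eqVlt; apply/orP; left; apply/eqP.
have E := @seg_int_periodic (fun s => u (circle_pt (turn a (t, 0)) r s)) (2 * pi) a a0 a2.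
rewrite -E//.
- by apply: seg_int_eq => s _; rewrite /k/= turn_circle_pt.
- exact: continuous_comp_all (@continuous_circle_pt _ _) cu.
- by move=> s; rewrite circle_pt2pi.
Qed.

(** A maximum principle for the radial function obtained by averaging u over
    rotations. Adding k t^2 makes the sub-mean-value property strict, so that a
    maximum over [0, rho] can only be attained at rho. *)
Lemma circle_int_le u rho t : continuous u -> (forall w, 0 <= u w) ->
  locally_submean rho u -> 0 <= t -> t <= rho ->
  circle_int u (t, 0) <= circle_int u (rho, 0).
Proof.
move=> cu u0 [d d0 sub] t0 trho.
have rho0 := le_trans t0 trho.
pose phi s := circle_int u (s, 0).
have cphi : continuous phi by exact: continuous_circle_int.
have main (k : R) : 0 < k -> phi t <= phi rho + k * rho ^+ 2.
  move=> k0; pose psi s := phi s + k * s ^+ 2.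
  have cpsi : {within `[0, rho], continuous psi}.
    apply: continuous_subspaceT => s; apply: cvgD; first exact: cphi.
    by apply: cvgMr; exact: exprn_continuous.
  have [T TI HT] := EVT_max rho0 cpsi.
  move: TI; rewrite in_itv/= => /andP[T0 Trho].
  have psile s : 0 <= s -> s <= rho -> psi s <= psi T by move=> ? ?; apply: HT;
    rewrite in_itv/=; apply/andP.
  suff TE : T = rho.
    have := psile t t0 trho; rewrite TE /psi; have := mulr_ge0 (ltW k0) (sqr_ge0 t); lra.
  apply/eqP; rewrite eq_le Trho/= leNgt; apply/negP => Tlt.
  (* The circle of radius r about (T, 0) stays in the disc of radius rho. *)
  pose r := Num.min d (rho - T) / 2.
  have mind : Num.min d (rho - T) <= d by rewrite ge_min lexx.
  have minT : Num.min d (rho - T) <= rho - T by rewrite ge_min lexx orbT.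
  have min0 : 0 < Num.min d (rho - T) by rewrite lt_min d0 subr_gt0.
  have r0 : 0 < r by rewrite divr_gt0.
  have rd : r < d by rewrite /r; lra.
  have rT : T + r <= rho by rewrite /r; lra.
  have subT w : modulus (toC w) = T ->
      2 * pi * u w <= seg_int 0 (2 * pi) (fun s => u (circle_pt w r s)).
    by move=> wT; apply: sub => //; rewrite wT.
  have := circle_int_submean cu u0 subT T0.
  rewrite leNgt => /negP; apply.
  have pi20 := @pi2_gt0 R.
  (* An upper bound for the circle means at the points of that circle, whose
     squared modulus is T^2 + 2 T r cos s + r^2. *)
  pose g s := phi T - k * r ^+ 2 - (2 * k * T * r) * cos s.
  have cc x : continuous (fun _ : R => x) by move=> ?; exact: cvg_cst.
  have cg1 : continuous (fun s => (2 * k * T * r) * cos s).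
    by move=> s; apply: cvgMr; exact: continuous_cos.
  have -> : 2 * pi * circle_int u (T, 0) = seg_int 0 (2 * pi) g + k * r ^+ 2 * (2 * pi).
    rewrite /g seg_intB; [|exact/continuous_ctn_on/cc|exact/continuous_ctn_on].
    rewrite seg_int_cst ?(ltW pi20)// seg_intZ; last exact/continuous_ctn_on/continuous_cos.
    by rewrite seg_int_cos /phi; ring.
  apply: (@le_lt_trans _ _ (seg_int 0 (2 * pi) g));
    last by rewrite ltrDl mulr_gt0// mulr_gt0// exprn_gt0.
  have cm : continuous (fun s => modulus (toC (circle_pt (T, 0) r s))).
    exact: (continuous_comp_all (@continuous_circle_pt (T, 0) r)
      (@continuous_modulus_pair R)).
  apply: le_seg_int.
  - by apply: continuous_ctn_on; exact: (continuous_comp_all cm cphi).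
  - by apply: continuous_ctn_on => s; apply: cvgB; [exact: cc|exact: cg1].
  move=> s _; set m := modulus _.
  have mE : m ^+ 2 = T ^+ 2 + 2 * T * r * cos s + r ^+ 2.
    have sinE : sin s ^+ 2 = 1 - cos s ^+ 2 by rewrite -(cos2Dsin2 s); ring.
    by rewrite sqr_modulus/= add0r exprMn sinE; ring.
  have m0 : 0 <= m by exact: modulus_ge0.
  have mrho : m <= rho.
    rewrite (le_trans _ rT)// -(@ler_pXn2r _ 2)// ?nnegrE ?addr_ge0// ?(ltW r0)// mE.
    have := mulr_ge0 T0 (ltW r0) => Tr.
    have := ler_wpM2l Tr (cos_le1 s); rewrite mulr1 sqrrD; lra.
  have := psile m m0 mrho; rewrite /psi mE /g /phi; lra.
apply/ler_addgt0Pr => e e0.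
have r1 : 0 < rho ^+ 2 + 1 by rewrite ltr_wpDl// sqr_ge0.
apply: (le_trans (main (e / (rho ^+ 2 + 1)) (divr_gt0 e0 r1))).
by rewrite lerD2l mulrAC ler_pdivrMr// ler_pM2l// lerDl.
Qed.

End RadialMean.

(** * Circle means of |f|^p for entire f *)

Section PowerMeans.
Context {R : realType}.
Implicit Types (f g : R[i] -> R[i]) (z : R[i]) (e d r t s p q : R) (n : nat).

Definition abs_pow p f w : R := modulus (f (toC w)) `^ p.

Lemma holo_cont_plane f (w : R * R) : holo f (toC w) -> forall e, 0 < e ->
  \forall w' \near w, modulus (f (toC w') - f (toC w)) < e.
Proof.
move=> hf e e0; have [d d0 Hd] := holo_cont hf e0.
have d20 : 0 < d / 2 by rewrite divr_gt0.
exists (ball w.1 (d / 2), ball w.2 (d / 2)) => /=.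
  by split; exact: nbhsx_ballx.
move=> w' [/= b1 b2]; apply: Hd.
rewrite (le_lt_trans (modulus_le _))//= (splitr d) ltrD//.
  by rewrite distrC.
by rewrite distrC.
Qed.

Lemma continuous_modulus f : (forall z, holo f z) ->
  continuous (fun w : R * R => modulus (f (toC w))).
Proof.
move=> hf w; apply/cvgrPdist_lt => e e0.
near=> w'.
apply: (@le_lt_trans _ _ (modulus (f (toC w') - f (toC w)))).
  have h1 := ler_modulus_trans (f (toC w)) (f (toC w')) 0.
  have h2 := ler_modulus_trans (f (toC w')) (f (toC w)) 0.
  rewrite !subr0 (modulusB (f (toC w))) in h1 h2.
  by rewrite ler_norml; apply/andP; split; lra.
by near: w'; exact: holo_cont_plane.
Unshelve. all: by end_near. Qed.

Lemma continuous_abs_pow p f : 0 < p -> (forall z, holo f z) -> continuous (abs_pow p f).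
Proof.
move=> p0 hf; apply: continuous_powR_ge0 => //; first by move=> w; exact: modulus_ge0.
exact: continuous_modulus.
Qed.

Lemma abs_pow_ge0 p f w : 0 <= abs_pow p f w.
Proof. exact: powR_ge0. Qed.

(** Uniform continuity on a disc, by compactness of the square around it. *)
Lemma holo_unif_cont f rho e : (forall z, holo f z) -> 0 < e ->
  exists2 d, 0 < d & forall w w', modulus (toC w) <= rho ->
    modulus (toC w' - toC w) < d -> modulus (f (toC w') - f (toC w)) < e.
Proof.
move=> hf e0; have e20 : 0 < e / 2 by rewrite divr_gt0.
pose A : set (R * R) := `[- rho, rho] `*` `[- rho, rho].
have cA : compact A by apply: compact_setX; exact: segment_compact.
pose P d w := forall w', modulus (toC w' - toC w) < d ->
  modulus (f (toC w') - f (toC w)) < e.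
have : \forall d \near 0^'+, A `<=` P d.
  apply: (compact_near_coveringP A).1 => // w _.
  have [d d0 Hd] := holo_cont (hf (toC w)) e20.
  have d40 : 0 < d / 4 by rewrite divr_gt0.
  exists (ball w.1 (d / 4) `*` ball w.2 (d / 4), [set d' | 0 < d' < d / 2]) => /=.
    split; first by exists (ball w.1 (d / 4), ball w.2 (d / 4)) => //=; split;
      exact: nbhsx_ballx.
    near=> d' => /=; apply/andP; split; first by [].
    by near: d'; apply: nbhs_right_lt; rewrite divr_gt0.
  move=> [w1 d'] /= [[b1 b2] /andP[d'0 d'd]] w' w'w1.
  have w1w : modulus (toC w1 - toC w) < d / 2.
    rewrite (le_lt_trans (modulus_le _))//= (_ : d / 2 = d / 4 + d / 4); last by field.
    by rewrite ltrD// distrC.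
  have w'w : modulus (toC w' - toC w) < d.
    by have := ler_modulus_trans (toC w') (toC w1) (toC w); lra.
  have w1d : modulus (toC w1 - toC w) < d by lra.
  have := Hd _ w'w; have := Hd _ w1d.
  have := ler_modulus_trans (f (toC w')) (f (toC w)) (f (toC w1)).
  by rewrite (modulusB (f (toC w)) (f (toC w1))); lra.
move=> [d /= d0 Hd]; exists (d / 2); first by rewrite divr_gt0.
move=> w w' wr w'w; apply: (Hd (d / 2)) => //=; rewrite ?divr_gt0//.
  by rewrite sub0r normrN gtr0_norm ?divr_gt0//; lra.
by split; rewrite /= in_itv/= -ler_norml (le_trans _ wr)//;
  [exact: normr_Re_le (toC w)|exact: normr_Im_le (toC w)].
Unshelve. all: by end_near. Qed.

Lemma toCE z : toC (complex.Re z, complex.Im z) = z.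
Proof. by case: z. Qed.

Lemma toC_circle_pt w r s : toC (circle_pt w r s) = polar (toC w) r s.
Proof. by []. Qed.

Lemma continuous_max_pow f e p : 0 < p -> (forall z, holo f z) ->
  continuous (fun w => Num.max (modulus (f (toC w))) e `^ p).
Proof.
move=> p0 hf; apply: continuous_powR_ge0 => //.
  by move=> w; rewrite le_max modulus_ge0.
by move=> w; apply: continuous_max; [exact: continuous_modulus|exact: cvg_cst].
Qed.

(** Truncating |f| from below makes the radius at which the sub-mean-value
    property holds uniform on discs: it is immediate where |f| < e, and
    elsewhere f keeps away from zero at a uniform distance. *)
Lemma locally_submean_max f p e rho : 0 < p -> 0 < e -> (forall z, holo f z) ->
  locally_submean rho (fun w => Num.max (modulus (f (toC w))) e `^ p).
Proof.
move=> p0 e0 hf; have [d d0 Hd] := @holo_unif_cont f rho e hf e0.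
have pi20 := @pi2_gt0 R.
have cmax := @continuous_max_pow f e p p0 hf.
exists d => // w r wr r0 rd.
have cseg : ctn_on 0 (2 * pi) (fun s =>
  Num.max (modulus (f (toC (circle_pt w r s)))) e `^ p).
  apply: continuous_ctn_on.
  exact: (continuous_comp_all (@continuous_circle_pt R w r) cmax).
have [fe|fe] := leP (modulus (f (toC w))) e.
  rewrite mulrC -[X in _ * X](subr0 (2 * pi)) -seg_int_cst; last exact: ltW.
  apply: le_seg_int => //; first by move=> ? _; exact: cst_continuous.
  move=> s _; apply: ge0_ler_powR;
    rewrite ?nnegrE ?(ltW p0) ?(ltW e0)// ?le_max ?lexx ?orbT ?(ltW e0) ?orbT//.
have cs : ctn_on 0 (2 * pi) (fun s => modulus (f (polar (toC w) r s)) `^ p).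
  apply: continuous_ctn_on.
  exact: (continuous_comp_all (@continuous_circle_pt R w r) (continuous_abs_pow p0 hf)).
have near_w z : modulus (z - toC w) < d -> modulus (f z - f (toC w)) < modulus (f (toC w)).
  move=> zd; apply: (lt_trans _ fe).
  by have := Hd w (complex.Re z, complex.Im z) wr; rewrite toCE; apply.
apply: (le_trans (@local_submean _ f (toC w) d r p p0 r0 rd (fun z _ => hf z) near_w cs)).
apply: le_seg_int => // s _; rewrite toC_circle_pt.
by apply: ge0_ler_powR; rewrite ?nnegrE ?(ltW p0) ?modulus_ge0 ?le_max ?modulus_ge0 ?lexx.
Qed.

Lemma maxr_powR_le (a e p : R) : Num.max a e `^ p <= a `^ p + e `^ p.
Proof.
by case: (leP a e) => _; [rewrite lerDr|rewrite lerDl]; exact: powR_ge0.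
Qed.

(** Hardy's theorem on the growth of the means of |f|^p. The truncated functions
    max(|f|, e)^p obey the maximum principle and exceed |f|^p by at most e^p, so
    e may tend to 0. *)
Theorem circle_int_abs_pow_le f p t r : 0 < p -> (forall z, holo f z) -> 0 <= t -> t <= r ->
  circle_int (abs_pow p f) (t, 0) <= circle_int (abs_pow p f) (r, 0).
Proof.
move=> p0 hf t0 tr; apply/ler_addgt0Pr => d d0.
have pi20 := @pi2_gt0 R.
have dpi0 : 0 < d / (2 * pi) by rewrite divr_gt0.
(* The truncation level e is such that 2 pi e^p = d. *)
pose e := (d / (2 * pi)) `^ p^-1.
have e0 : 0 < e by rewrite powR_gt0.
have ep : e `^ p = d / (2 * pi) by rewrite /e -powRrM mulVf ?gt_eqF// powRr1// ltW.
pose u w := Num.max (modulus (f (toC w))) e `^ p.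
have cu : continuous u by exact: continuous_max_pow.
have cf := continuous_abs_pow p0 hf.
have H := circle_int_le cu (fun w => powR_ge0 _ _) (locally_submean_max r p0 e0 hf) t0 tr.
apply: (@le_trans _ _ (circle_int u (t, 0))).
  apply: le_seg_int; try by apply: continuous_ctn_on; exact: continuous_circle.
  move=> s _; apply: ge0_ler_powR;
    rewrite ?nnegrE ?(ltW p0) ?modulus_ge0 ?le_max ?modulus_ge0 ?lexx//.
apply: (le_trans H).
have -> : d = seg_int 0 (2 * pi) (fun=> e `^ p).
  by rewrite seg_int_cst ?(ltW pi20)// ep subr0 divfK// gt_eqF.
rewrite /circle_int -seg_intD; first last.
- by move=> ? _; exact: cst_continuous.
- by apply: continuous_ctn_on; exact: continuous_circle.
apply: le_seg_int.
- by apply: continuous_ctn_on; exact: continuous_circle.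
- move=> s _; apply: cvgD; last exact: cvg_cst.
  exact: (@continuous_circle _ _ (r, 0) cf).
- by move=> s _; exact: maxr_powR_le.
Qed.

Lemma turn0 t : turn t (0, 0) = (0, 0) :> R * R.
Proof. by rewrite /turn /rotate/= !mulr0 subr0 addr0. Qed.

Lemma circle_int0 (u : R * R -> R) : circle_int u (0, 0) = 2 * pi * u (0, 0).
Proof.
rewrite /circle_int; under seg_int_eq do rewrite turn0.
by rewrite seg_int_cst ?subr0 ?(ltW pi2_gt0)// mulrC.
Qed.

Lemma toC_turn_polar t s : toC (turn s (t, 0)) = polar 0 t s :> R[i].
Proof.
rewrite /polar add0r /toC /turn /rotate/= !mulr0 subr0 addr0.
by rewrite (mulrC t) (mulrC t).
Qed.

Lemma powR_half_sqr (a p : R) : 0 <= a -> 0 < p -> (a `^ (p / 2)) ^+ 2 = a `^ p.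
Proof. by move=> a0 p0; rewrite -powR_mulrn ?powR_ge0// -powRrM divfK. Qed.

(** For A the value of |f|^(p/2) at the centre, X and Y the integrals of |f|^p and
    |f|^(p/2) over a circle and P the length of the parameter interval, the
    left-hand side is the integral of (|f|^(p/2) - A)^2. *)
Lemma variance_le0 (X Y P A : R) : 0 <= A -> X <= P * A ^+ 2 -> P * A <= Y ->
  X - 2 * A * Y + A ^+ 2 * P <= 0.
Proof. by move=> A0 XP /(ler_wpM2l A0); lra. Qed.

(** Equality of the p-means at radius r and at the centre forces, through the
    variance of |f|^(p/2), |f| = |f(0)| on the disc. *)
Lemma circle_int_eq_modulus f p r : 0 < p -> (forall z, holo f z) ->
  circle_int (abs_pow p f) (r, 0) <= 2 * pi * modulus (f 0) `^ p ->
  forall z, modulus z <= r -> modulus (f z) = modulus (f 0).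
Proof.
move=> p0 hf Ur z zr.
have pi20 := @pi2_gt0 R.
have p20 : 0 < p / 2 by rewrite divr_gt0.
set t := modulus z in zr; have t0 : 0 <= t by exact: modulus_ge0.
pose A := modulus (f 0) `^ (p / 2).
have A0 : 0 <= A by exact: powR_ge0.
have A2 : A ^+ 2 = modulus (f 0) `^ p by rewrite powR_half_sqr// modulus_ge0.
have Up : circle_int (abs_pow p f) (t, 0) <= 2 * pi * A ^+ 2.
  by rewrite A2; apply: (le_trans _ Ur); exact: circle_int_abs_pow_le.
have Uq : 2 * pi * A <= circle_int (abs_pow (p / 2) f) (t, 0).
  by rewrite -(@circle_int0 (abs_pow (p / 2) f)); exact: circle_int_abs_pow_le.
pose G s := (abs_pow (p / 2) f (turn s (t, 0)) - A) ^+ 2.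
have cp := @continuous_circle _ _ (t, 0) (continuous_abs_pow p0 hf).
have cq := @continuous_circle _ _ (t, 0) (continuous_abs_pow p20 hf).
have cc (x : R) : continuous (fun _ : R => x) by move=> ?; exact: cvg_cst.
have GE : G = fun s => abs_pow p f (turn s (t, 0)) - (2 * A) * abs_pow (p / 2) f (turn s
  (t, 0)) + A ^+ 2.
  apply/funext => s; rewrite /G sqrrB /abs_pow powR_half_sqr ?modulus_ge0//.
  by rewrite [_ *+ 2](_ : _ = 2 * A * modulus (f (toC (turn s (t, 0)))) `^ (p / 2))//; ring.
have c2 : continuous (fun s => (2 * A) * abs_pow (p / 2) f (turn s (t, 0))).
  by move=> s; apply: cvgMr; exact: cq.
have c1 : continuous (fun s =>
  abs_pow p f (turn s (t, 0)) - (2 * A) * abs_pow (p / 2) f (turn s (t, 0))).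
  by move=> s; apply: cvgB; [exact: cp|exact: c2].
have cG : continuous G by rewrite GE => s; apply: cvgD; [exact: c1|exact: cc].
have IG : seg_int 0 (2 * pi) G <= 0.
  rewrite GE seg_intD; [|exact: continuous_ctn_on|exact/continuous_ctn_on/cc].
  rewrite seg_intB; [|exact: continuous_ctn_on|exact: continuous_ctn_on].
  rewrite seg_intZ; last exact: continuous_ctn_on.
  rewrite seg_int_cst ?(ltW pi20)// subr0.
  rewrite -/(circle_int (abs_pow p f) (t, 0)) -/(circle_int (abs_pow (p / 2) f) (t, 0)).
  exact: variance_le0.
have G0 := seg_int_le0_eq0 pi20 (continuous_ctn_on cG) (fun s _ => sqr_ge0 _) IG.
have [s sI zE] := turn_radius (complex.Re z, complex.Im z).
have zC := toCE z.
have := G0 s; rewrite in_itv/= sI => /(_ isT) /eqP.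
rewrite sqrf_eq0 subr_eq0 => /eqP.
rewrite zC in zE; rewrite /abs_pow -zE zC => /(powR_injective p20).
by apply; rewrite nnegrE modulus_ge0.
Qed.

(** The mean of Re(f / f(0)) over a circle is 1 and Re(f / f(0)) <= 1 there, so
    equality holds at every point of the circle. *)
Lemma constant_on_disc f r : (forall z, holo f z) ->
  (forall z, modulus z <= r -> modulus (f z) = modulus (f 0)) ->
  forall z, modulus z <= r -> f z = f 0.
Proof.
move=> hf mf z zr.
have pi20 := @pi2_gt0 R.
have [f00|f00] := eqVneq (f 0) 0.
  by apply/eqP; rewrite f00 -modulus_eq0 mf// f00 modulus0.
have [->//|z0] := eqVneq z 0.
set t := modulus z in zr; have t0 : 0 < t by rewrite modulus_gt0.
have hg w : holo (fun w => f w * (f 0)^-1) w by apply: holoM => //; exact: holo_cst.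
have M := @mean_value _ _ 0 (t + 1) t t0 ltac:(lra) (fun w _ => hg w).
rewrite mulfV//= mulr1 in M.
have cR : continuous (fun s => complex.Re (f (polar 0 t s) * (f 0)^-1)).
  exact: (@continuous_polar_Re _ (fun w => f w * (f 0)^-1) 0 t (ltW t0) (fun w _ => hg w)).
pose G s := 1 - complex.Re (f (polar 0 t s) * (f 0)^-1).
have cc (x : R) : continuous (fun _ : R => x) by move=> ?; exact: cvg_cst.
have mg s : modulus (f (polar 0 t s) * (f 0)^-1) = 1.
  rewrite modulusM modulusV mf ?mulfV ?modulus_eq0//.
  by have := modulus_polarB 0 s (ltW t0); rewrite subr0 => ->.
have IG : seg_int 0 (2 * pi) G <= 0.
  rewrite /G seg_intB; [|exact/continuous_ctn_on/cc|exact/continuous_ctn_on].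
  by rewrite M seg_int_cst ?(ltW pi20)// mul1r subr0 subrr.
have G0 s : 0 <= G s.
  by rewrite subr_ge0 -(mg s) (le_trans (ler_norm _))// normr_Re_le.
have cG : ctn_on 0 (2 * pi) G by apply: continuous_ctn_on => s; apply: cvgB;
  [exact: cc|exact: cR].
have [s sI zE] := turn_radius (complex.Re z, complex.Im z).
have zC := toCE z.
have sI' : s \in `[0, 2 * pi] by rewrite in_itv.
have /eqP := seg_int_le0_eq0 pi20 cG (fun s _ => G0 s) IG sI';
  rewrite /G subr_eq0 eq_sym => /eqP.
have zP : polar 0 t s = z by rewrite -toC_turn_polar -[in RHS]zC zE zC.
rewrite zP => Re1; have := mg s; rewrite zP => m1.
have Im0 : complex.Im (f z / f 0) = 0.
  apply/eqP; rewrite -sqrf_eq0; apply/eqP.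
  by have := sqr_modulus (f z / f 0); rewrite m1 Re1 expr1n; lra.
have : f z / f 0 = 1 by case: (f z / f 0) Re1 Im0 => a b /= -> ->.
by move=> /(congr1 (fun x => x * f 0)); rewrite divfK// mul1r.
Qed.

(** Identity theorem at the origin. A function g that vanishes near 0 may be
    divided by every power of z, and monotonicity of the circle means of
    g / z^n bounds those of g at radius s by 2^-n times those at 2s. *)
Lemma holo_eq0 g r : 0 < r -> (forall z, holo g z) ->
  (forall z, modulus z <= r -> g z = 0) -> forall z, g z = 0.
Proof.
move=> r0 hg gr z.
have [->|z0] := eqVneq z 0; first by apply: gr; rewrite modulus0 ltW.
have pi20 := @pi2_gt0 R.
pose gn n w := g w * (w^-1) ^+ n.
have hgn n w : holo (gn n) w.
  have [w0|w0] := eqVneq w 0.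
    rewrite w0; apply: (@holo_near _ (fun=> 0) _ 0 r r0); last exact: holo_cst.
    by move=> v; rewrite subr0 => vr; rewrite /gn gr ?mul0r// ltW.
  apply: holoM; first exact: hg.
  elim: n => [|n IH]; first by under eq_fun do rewrite expr0; exact: holo_cst.
  by under eq_fun do rewrite exprS; apply: holoM => //; exact: holoV.
pose U (h : R[i] -> R[i]) s := circle_int (abs_pow 1 h) (s, 0).
have Ugn n s : 0 < s -> U (gn n) s = (s^-1) ^+ n * U g s.
  move=> s0; rewrite /U /circle_int -seg_intZ; last first.
    by apply: continuous_ctn_on; apply: continuous_circle; exact: continuous_abs_pow.
  apply: seg_int_eq => t _;
    rewrite /abs_pow !powRr1 ?modulus_ge0// /gn modulusM modulusX modulusV mulrC.
  congr (_^-1 ^+ _ * _).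
  by rewrite toC_turn_polar; have := modulus_polarB 0 t (ltW s0); rewrite subr0.
set s := modulus z; have s0 : 0 < s by rewrite modulus_gt0.
have s20 : 0 < 2 * s by rewrite mulr_gt0.
have Un n : 2 ^+ n * U g s <= U g (2 * s).
  have := @circle_int_abs_pow_le (gn n) 1 s (2 * s) ltr01 (hgn n) (ltW s0) ltac:(lra).
  rewrite -/(U _ _) -/(U _ _) !Ugn// !exprVn exprMn invfM -mulrA (mulrCA (2 ^+ n)^-1).
  by rewrite ler_pM2l ?invr_gt0 ?exprn_gt0// mulrC ler_pdivlMr ?exprn_gt0// mulrC.
have U0 : U g s <= 0.
  rewrite leNgt; apply/negP => Us.
  (* The exponent n is chosen with 2^n larger than U g (2 s) / U g s. *)
  have := Un (Num.truncn (U g (2 * s) / U g s)).+1; rewrite leNgt => /negP; apply.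
  rewrite -ltr_pdivrMr// (lt_le_trans (truncnS_gt _))// -natrX ler_nat ltnW// ltn_expl//.
have cU : ctn_on 0 (2 * pi) (fun t => abs_pow 1 g (turn t (s, 0))).
  by apply: continuous_ctn_on; apply: continuous_circle; exact: continuous_abs_pow.
have [t tI zE] := turn_radius (complex.Re z, complex.Im z).
have zC := toCE z.
have tI' : t \in `[0, 2 * pi] by rewrite in_itv.
have := seg_int_le0_eq0 pi20 cU (fun t _ => abs_pow_ge0 _ _ _) U0 tI'.
rewrite zC in zE.
rewrite /abs_pow -zE zC powRr1 ?modulus_ge0// => /eqP.
by rewrite modulus_eq0 => /eqP.
Qed.

(** Equality at one radius would make f constant on a disc, hence everywhere by
    the identity theorem. *)
Theorem circle_int_abs_pow_lt f p r : 0 < p -> (forall z, holo f z) -> ~ constant_fun f ->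
  0 < r -> 2 * pi * modulus (f 0) `^ p < circle_int (abs_pow p f) (r, 0).
Proof.
move=> p0 hf nconst r0; rewrite ltNge; apply/negP => Ur; apply: nconst.
have fr := constant_on_disc hf (circle_int_eq_modulus p0 hf Ur).
exists (f 0) => z; apply/eqP; rewrite -subr_eq0; apply/eqP.
apply: (@holo_eq0 (fun z => f z - f 0) r r0).
  by move=> w; apply: holoB => //; exact: holo_cst.
by move=> w wr; rewrite fr// subrr.
Qed.

End PowerMeans.

(** * Means over discs for a radial weight *)

Section RadialWeight.
Context {R : realType}.
Local Notation mu := (@lebesgue_measure R).
Local Notation mu2 := (mu \x mu)%E.
Local Notation mR := (measurableTypeR R).
Variable g : R * R -> R.
Hypothesis cg : continuous g.
Hypothesis g_gt0 : forall w, 0 < g w.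
Hypothesis gturn : forall t w, g (turn t w) = g w.
Implicit Types (u h : R * R -> R) (a b m r t : R).

Definition annulus a b : set (R * R) := [set w | a <= modulus (toC w) < b].

Definition annulus_int h a b : R := \int[mu2]_(w in annulus a b) (h w * g w).

Lemma measurable_annulus a b : measurable (annulus a b : set (mR * mR)).
Proof.
have := continuous_measurable_plane (@continuous_modulus_pair R).
move=> /(_ measurableT `[a, b[%classic (measurable_itv _)).
by rewrite setTI.
Qed.

Lemma annulus_box a b w : annulus a b w -> (`[- b, b] `*` `[- b, b])%classic w.
Proof.
move=> /andP[_ /ltW wb]; split; rewrite /= in_itv/= -ler_norml (le_trans _ wb)//.
  exact: normr_Re_le (toC w).
exact: normr_Im_le (toC w).
Qed.

Lemma measurable_mul_weight h : continuous h ->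
  measurable_fun [set: mR * mR] (fun w => h w * g w).
Proof.
by move=> ch; apply: continuous_measurable_plane => w; apply: cvgM; [exact: ch|exact: cg].
Qed.

Lemma compact_box a b c d : compact (`[a, b] `*` `[c, d] : set (R * R)).
Proof. by apply: compact_setX; exact: segment_compact. Qed.

Lemma annulus_integrable h a b : 0 <= b -> continuous h ->
  mu2.-integrable (annulus a b) (EFin \o (fun w => h w * g w)).
Proof.
move=> b0 ch.
have mh := measurable_mul_weight ch.
apply/integrableP; split.
  by apply/measurable_EFinP; exact: measurable_funTS.
have bb : - b <= b by rewrite (le_trans _ b0)// oppr_le0.
pose B : set (R * R) := (`[- b, b] `*` `[- b, b])%classic.
have mB : measurable (B : set (mR * mR)) by apply: measurableX; exact: measurable_itv.
have A0 : B !=set0 by exists (b, b); split; rewrite /= in_itv/= lexx bb.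
have cn : {within B, continuous (fun w => `|h w * g w|)}.
  apply: continuous_subspaceT => w; apply: (@continuous_comp _ _ _ (fun w => h w * g w));
    last exact: norm_continuous.
  by apply: cvgM; [exact: ch|exact: cg].
have [w0 _ Hw] := compact_EVT_max A0 (@compact_box _ _ _ _) cn.
set K := `|h w0 * g w0| in Hw.
apply: (@le_lt_trans _ _ (\int[mu2]_(w in B) (cst K%:E) w)%E).
  apply: (@le_trans _ _ (\int[mu2]_(w in annulus a b) (cst K%:E) w)%E).
    apply: ge0_le_integral => //=; first exact: measurable_annulus.
      by apply/measurable_EFinP; apply: measurable_funTS; apply: measurableT_comp.
    by move=> w /annulus_box wB; rewrite lee_fin; apply: Hw; rewrite inE.
  apply: ge0_subset_integral => //=.
  - exact: measurable_annulus.
  - by move=> w _; rewrite lee_fin /K.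
  - by move=> w /annulus_box.
rewrite integral_cst// (_ : _ * _ = (K * ((b - - b) * (b - - b)))%:E)%E ?ltry//.
by rewrite EFinM; congr (_ * _)%E; exact: plane_measure_box.
Qed.

Lemma annulus_intE h a b : 0 <= b -> continuous h ->
  (\int[mu2]_(w in annulus a b) (h w * g w)%:E)%E = (annulus_int h a b)%:E.
Proof.
move=> b0 ch; rewrite /annulus_int /Rintegral fineK//.
by apply: integrable_fin_num; [exact: measurable_annulus|exact: annulus_integrable].
Qed.

Lemma le_annulus_int h1 h2 a b : 0 <= b -> continuous h1 -> continuous h2 ->
  (forall w, annulus a b w -> h1 w <= h2 w) -> annulus_int h1 a b <= annulus_int h2 a b.
Proof.
move=> b0 c1 c2 h12; apply: le_Rintegral; first exact: measurable_annulus.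
- exact: annulus_integrable.
- exact: annulus_integrable.
- by move=> w wA; rewrite ler_wpM2r ?h12// ltW.
Qed.

Lemma annulus_int_cst c a b : 0 <= b ->
  annulus_int (fun=> c) a b = c * annulus_int (fun=> 1) a b.
Proof.
move=> b0; rewrite /annulus_int -RintegralZl.
- by apply: eq_Rintegral => w _; rewrite mul1r.
- exact: measurable_annulus.
- by apply: annulus_integrable => // w; exact: cvg_cst.
Qed.

Lemma annulus_int_split h a m b : a <= m -> m <= b -> 0 <= b -> continuous h ->
  annulus_int h a b = annulus_int h a m + annulus_int h m b.
Proof.
move=> am mb b0 ch.
have E : annulus a b = annulus a m `|` annulus m b.
  apply/seteqP; split => w; rewrite /annulus/=.
    by move=> /andP[aw wb]; case: (ltP (modulus (toC w)) m) => wm; [left;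
      rewrite aw|right; rewrite wb].
  by move=> [/andP[aw wm]|/andP[mw wb]]; apply/andP; split => //;
    [exact: lt_le_trans mb|exact: le_trans mw].
rewrite /annulus_int E Rintegral_setU//.
- exact: measurable_annulus.
- exact: measurable_annulus.
- by rewrite -E; exact: annulus_integrable.
- apply/disj_setPS => w [/= /andP[_ wm] /andP[mw _]].
  by move: (lt_le_trans wm mw); rewrite ltxx.
Qed.

(** The annulus contains a square of positive area, on which the weight is
    bounded below. *)
Lemma annulus_mass_gt0 a b : 0 <= a -> a < b -> 0 < annulus_int (fun=> 1) a b.
Proof.
move=> a0 ab; have b0 : 0 <= b by rewrite (le_trans a0)// ltW.
pose k := (b - a) / 3; have k0 : 0 < k by rewrite divr_gt0// subr_gt0.
pose Q : set (R * R) := `[a, a + k] `*` `[0, k].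
have mQ : measurable (Q : set (mR * mR)) by apply: measurableX; exact: measurable_itv.
have QA : Q `<=` annulus a b.
  move=> w [/=]; rewrite !in_itv/= => /andP[x1 x2] /andP[y1 y2]; apply/andP; split.
    by rewrite (le_trans x1)// (le_trans (ler_norm _))//; exact: normr_Re_le (toC w).
  rewrite (le_lt_trans (modulus_le _))//= !ger0_norm//; last exact: le_trans x1.
  by rewrite /k in x2 y2; lra.
have Q0 : Q !=set0 by exists (a, 0); split; rewrite /= in_itv/= lexx ?lerDl ltW.
have [w0 _ Hw] := compact_EVT_min Q0 (@compact_box _ _ _ _) (continuous_subspaceT cg).
have m1 : measurable_fun [set: mR * mR] (fun w => 1 * g w).
  by apply: measurable_mul_weight => w; exact: cvg_cst.
rewrite -lte_fin -annulus_intE//; last by move=> w; exact: cvg_cst.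
apply: (@lt_le_trans _ _ (\int[mu2]_(w in Q) (cst (g w0)%:E) w)%E).
  rewrite integral_cst// (_ : _ * _ = (g w0 * ((a + k - a) * (k - 0)))%:E)%E.
    by rewrite lte_fin mulr_gt0// mulr_gt0// ?subr0// addrC addKr.
  rewrite EFinM; congr (_ * _)%E.
  by apply: plane_measure_box; rewrite ?lerDl ltW.
apply: (@le_trans _ _ (\int[mu2]_(w in Q) (1 * g w)%:E)%E).
  apply: ge0_le_integral => //=.
  - by move=> w _; rewrite lee_fin ltW.
  - by apply/measurable_EFinP; exact: measurable_funTS.
  - by move=> w wQ; rewrite lee_fin mul1r; apply: Hw; rewrite inE.
apply: ge0_subset_integral => //=; first exact: measurable_annulus.
  by apply/measurable_EFinP; exact: measurable_funTS.
by move=> w _; rewrite lee_fin mul1r ltW.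
Qed.

Lemma continuous_circle_int_plane u : continuous u -> (forall w, 0 <= u w) ->
  continuous (circle_int u).
Proof.
move=> cu u0; rewrite (_ : circle_int u = fun w => circle_int u (modulus (toC w), 0)).
  exact: (continuous_comp_all (@continuous_modulus_pair R) (continuous_circle_int cu)).
by apply/funext => w; exact: circle_int_radial.
Qed.

Lemma annulus_int_circle u a b : 0 <= b -> continuous u -> (forall w, 0 <= u w) ->
  annulus_int (circle_int u) a b = 2 * pi * annulus_int u a b.
Proof.
move=> b0 cu u0; apply: EFin_inj; rewrite EFinM -!annulus_intE//;
  last exact: continuous_circle_int_plane.
have mA := @measurable_annulus a b.
pose gA w := g w * \1_(annulus a b) w.
have mgA : measurable_fun [set: mR * mR] gA.
  apply: measurable_funM; last exact: measurable_indic.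
  exact: continuous_measurable_plane.
have gA0 w : 0 <= gA w by rewrite mulr_ge0// ?ltW// indicE.
have gAturn t w : gA (turn t w) = gA w.
  rewrite /gA gturn !indicE; congr (_ * (nat_of_bool _)%:R).
  by apply/idP/idP; rewrite !inE /annulus/= modulus_turn.
have E (h : R * R -> R) : (\int[mu2]_(w in annulus a b) (h w * g w)%:E =
    \int[mu2]_w (h w * gA w)%:E)%E.
  rewrite integral_mkcond; apply: eq_integral => w _; rewrite patchE /gA indicE.
  by case: ifP => _; rewrite ?mulr1// !mulr0.
by rewrite !E; exact: ge0_integral_circle.
Qed.

Definition disc_mean u r : R := annulus_int u 0 r / annulus_int (fun=> 1) 0 r.

(** Monotonicity of the circle means in the radius, the property of |f|^p that
    the comparison of disc means rests on. *)
Definition circle_mono u := forall s t, 0 <= s -> s <= t ->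
  circle_int u (s, 0) <= circle_int u (t, 0).

Lemma annulus_int_le u a b : continuous u -> (forall w, 0 <= u w) -> circle_mono u ->
  0 <= a -> a <= b ->
  2 * pi * annulus_int u a b <= circle_int u (b, 0) * annulus_int (fun=> 1) a b.
Proof.
move=> cu u0 um a0 ab; have b0 := le_trans a0 ab.
rewrite -(@annulus_int_circle u a b b0 cu u0) -(annulus_int_cst _ a b0).
apply: le_annulus_int => //; first exact: continuous_circle_int_plane.
  by move=> w; exact: cvg_cst.
move=> w /andP[aw wb]; rewrite circle_int_radial//.
by apply: um; [exact: modulus_ge0|exact: ltW].
Qed.

Lemma annulus_int_ge u a b : continuous u -> (forall w, 0 <= u w) -> circle_mono u ->
  0 <= a -> a <= b ->
  circle_int u (a, 0) * annulus_int (fun=> 1) a b <= 2 * pi * annulus_int u a b.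
Proof.
move=> cu u0 um a0 ab; have b0 := le_trans a0 ab.
rewrite -(@annulus_int_circle u a b b0 cu u0) -(annulus_int_cst _ a b0).
apply: le_annulus_int => //; last first.
- move=> w /andP[aw wb]; rewrite (circle_int_radial w)//; exact: um.
- exact: continuous_circle_int_plane.
- by move=> w; exact: cvg_cst.
Qed.

(** Comparison through the value m of the circle mean at radius r1: on the disc
    of radius r1 the weighted mean is below m, strictly because the circle means
    near 0 are, while on the surrounding annulus it is at least m. *)
Lemma disc_mean_lt u r1 r2 : continuous u -> (forall w, 0 <= u w) -> circle_mono u ->
  0 < r1 -> r1 < r2 -> circle_int u (0, 0) < circle_int u (r1, 0) ->
  disc_mean u r1 < disc_mean u r2.
Proof.
move=> cu u0 um r10 r12 U01; have r20 := lt_trans r10 r12.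
have pi20 := @pi2_gt0 R.
have [t t0 /andP[tr Ut]] : exists2 t, 0 < t & (t < r1) && (circle_int u (t, 0) <
  circle_int u (r1, 0)).
  have := continuous_circle_int cu.
  move=> /(_ 0) cU.
  have : \forall t \near 0^'+, [/\ 0 < t, t < r1 & circle_int u (t, 0) <
    circle_int u (r1, 0)].
    near=> t; split; first by [].
      by near: t; exact: nbhs_right_lt.
    near: t; apply: cvg_within; exact: (cvgr_lt (circle_int u (0, 0)) cU).
  by move=> /filter_ex[t [? ? ?]]; exists t => //; apply/andP.
pose B a b := annulus_int (fun=> 1) a b; pose S a b := annulus_int u a b.
have cc : continuous (fun _ : R * R => 1 : R) by move=> w; exact: cvg_cst.
have r1l := ltW r10; have r2l := ltW r20; have tl := ltW t0; have tr1 := ltW tr;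
  have rr := ltW r12.
have B1 : 0 < B 0 r1 by exact: annulus_mass_gt0.
have B2 : 0 < B 0 r2 by exact: annulus_mass_gt0.
have Bt : 0 < B 0 t by exact: annulus_mass_gt0.
have BA : 0 < B r1 r2 by exact: annulus_mass_gt0.
have BE1 : B 0 r1 = B 0 t + B t r1 by exact: annulus_int_split.
have BE2 : B 0 r2 = B 0 r1 + B r1 r2 by exact: annulus_int_split.
have SE1 : S 0 r1 = S 0 t + S t r1 by exact: annulus_int_split.
have SE2 : S 0 r2 = S 0 r1 + S r1 r2 by exact: annulus_int_split.
have S1 : 2 * pi * S 0 t <= circle_int u (t, 0) * B 0 t by exact: annulus_int_le.
have S2 : 2 * pi * S t r1 <= circle_int u (r1, 0) * B t r1 by exact: annulus_int_le.
have S3 : circle_int u (r1, 0) * B r1 r2 <= 2 * pi * S r1 r2 by exact: annulus_int_ge.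
have S4 : 2 * pi * S 0 r1 < circle_int u (r1, 0) * B 0 r1.
  rewrite SE1 BE1 (mulrDr (2 * pi)) (mulrDr (circle_int u (r1, 0))).
  by apply: ltr_leD => //; apply: (le_lt_trans S1); rewrite ltr_pM2r.
rewrite /disc_mean -/(S 0 r1) -/(S 0 r2) -/(B 0 r1) -/(B 0 r2).
rewrite ltr_pdivrMr// mulrAC ltr_pdivlMr// SE2 BE2 mulrDr mulrDl ltrD2l.
rewrite -(ltr_pM2l pi20) !mulrA.
apply: (@lt_le_trans _ _ (circle_int u (r1, 0) * B 0 r1 * B r1 r2));
  first by rewrite ltr_pM2r.
by rewrite mulrAC ler_pM2r.
Unshelve. all: by end_near. Qed.

Lemma disc_mean_bounds u r : continuous u -> (forall w, 0 <= u w) -> circle_mono u ->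
  0 < r ->
  u (0, 0) <= disc_mean u r <= circle_int u (r, 0) / (2 * pi).
Proof.
move=> cu u0 um r0; have pi20 := @pi2_gt0 R; have r0l := ltW r0.
have B1 : 0 < annulus_int (fun=> 1) 0 r by exact: annulus_mass_gt0.
rewrite /disc_mean; apply/andP; split.
  rewrite ler_pdivlMr// -(ler_pM2l pi20) mulrA -circle_int0.
  exact: annulus_int_ge.
rewrite ler_pdivrMr// mulrAC ler_pdivlMr// mulrC; exact: annulus_int_le.
Qed.

Lemma disc_mean_cst c r : 0 < r -> disc_mean (fun=> c) r = c.
Proof.
move=> r0; rewrite /disc_mean annulus_int_cst ?(ltW r0)// mulfK// gt_eqF//.
exact: annulus_mass_gt0.
Qed.

Lemma cvg_disc_mean u : continuous u -> (forall w, 0 <= u w) -> circle_mono u ->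
  disc_mean u r @[r --> 0^'+] --> u (0, 0).
Proof.
move=> cu u0 um; have pi20 := @pi2_gt0 R.
have cU := continuous_circle_int cu.
apply: (@squeeze_cvgr _ _ _ _ (fun=> u (0, 0)) (fun r => circle_int u (r, 0) / (2 * pi))).
- near=> r; apply: disc_mean_bounds => //.
- exact: cvg_cst.
- have -> : u (0, 0) = circle_int u (0, 0) / (2 * pi)
  by rewrite circle_int0 mulrAC mulfV ?mul1r// gt_eqF.
  by apply: cvgMl; apply: cvg_within_filter; exact: cU.
Unshelve. all: by end_near. Qed.

End RadialWeight.

(** * Gaussian integral means *)

Section GaussianMeans.
Context {R : realType}.
Implicit Types (p alpha r : R) (f : R[i] -> R[i]).

Definition gauss_weight alpha (w : R * R) : R := expR (- alpha * modulus (toC w) ^+ 2).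

Lemma continuous_gauss_weight alpha : continuous (gauss_weight alpha).
Proof.
apply: (@continuous_comp_all _ _ _ (fun w => - alpha * modulus (toC w) ^+ 2) expR);
  last exact: continuous_expR.
by move=> w; apply: cvgMr; apply: cvgM; exact: continuous_modulus_pair.
Qed.

Lemma gauss_weight_gt0 alpha w : 0 < gauss_weight alpha w.
Proof. exact: expR_gt0. Qed.

Lemma gauss_weight_turn alpha t w : gauss_weight alpha (turn t w) = gauss_weight alpha w.
Proof. by rewrite /gauss_weight modulus_turn. Qed.

Lemma disc_annulus r : disc r = annulus 0 r :> set (R * R).
Proof. by apply/seteqP; split => w; rewrite /disc /annulus/= modulus_ge0. Qed.

Lemma gaussian_meanE p alpha f r : 0 < p -> entire f -> 0 < r ->
  gaussian_mean p alpha f r = (disc_mean (gauss_weight alpha) (abs_pow p f) r)%:E.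
Proof.
move=> p0 ef r0; have r0l := ltW r0.
have cg := @continuous_gauss_weight alpha.
have cu := continuous_abs_pow p0 (entire_holo ef).
have c1 : continuous (fun _ : R * R => 1 : R) by move=> w; exact: cvg_cst.
have B0 := annulus_mass_gt0 cg (gauss_weight_gt0 alpha) (lexx 0) r0.
rewrite /gaussian_mean /area_integral disc_annulus.
have -> := annulus_intE cg 0 r0l cu.
have -> : (\int[lebesgue_measure \x lebesgue_measure]_(w in annulus 0 r)
    (expR (- alpha * modulus (toC w) ^+ 2))%:E)%E =
    (annulus_int (gauss_weight alpha) (fun=> 1) 0 r)%:E.
  rewrite -(annulus_intE cg)//.
  by apply: eq_integral => w _; rewrite mul1r.
by rewrite inver gt_eqF// -EFinM.
Qed.

End GaussianMeans.

Theorem mainTheorem1 (R : realType) (p alpha : R) (f : R[i] -> R[i])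
    (hp : 0 < p) (hf : entire f) :
  (~ constant_fun f ->
     forall r1 r2 : R, 0 < r1 -> r1 < r2 ->
       (gaussian_mean p alpha f r1 < gaussian_mean p alpha f r2)%E) /\
  cvg (gaussian_mean p alpha f r @[r --> 0^'+]) /\
  cvg (gaussian_mean p alpha f r @[r --> +oo%R]) /\
  (modulus (f 0) `^ p)%:E = gaussian_mean_at0 p alpha f /\
  forall r : R, 0 < r ->
    (gaussian_mean_at0 p alpha f <= gaussian_mean p alpha f r)%E /\
    (gaussian_mean p alpha f r <= gaussian_mean_at_infty p alpha f)%E /\
    (gaussian_mean_at0 p alpha f = gaussian_mean p alpha f r
       <-> constant_fun f) /\
    (gaussian_mean p alpha f r = gaussian_mean_at_infty p alpha f
       <-> constant_fun f).
Proof.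
have holof := entire_holo hf.
have cg := @continuous_gauss_weight R alpha.
have g0 := @gauss_weight_gt0 R alpha.
have gturn := @gauss_weight_turn R alpha.
have cu := continuous_abs_pow hp holof.
have u0 := @abs_pow_ge0 R p f.
have um : circle_mono (abs_pow p f) by move=> s t; exact: circle_int_abs_pow_le.
pose M := disc_mean (gauss_weight alpha) (abs_pow p f).
have ME r : 0 < r -> gaussian_mean p alpha f r = (M r)%:E by exact: gaussian_meanE.
have Mlt : ~ constant_fun f -> forall r1 r2, 0 < r1 -> r1 < r2 -> M r1 < M r2.
  move=> nconst r1 r2 r10 r12; apply: disc_mean_lt => //.
  by rewrite circle_int0; exact: circle_int_abs_pow_lt.
have Mcst : constant_fun f -> forall r, 0 < r -> M r = modulus (f 0) `^ p.
  move=> [c fc] r r0; rewrite /M (_ : abs_pow p f = fun=> modulus (f 0) `^ p).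
    exact: disc_mean_cst.
  by apply/funext => w; rewrite /abs_pow !fc.
have Mle r1 r2 : 0 < r1 -> r1 <= r2 -> M r1 <= M r2.
  move=> r10 r12; have [cf|ncf] := pselect (constant_fun f).
    by rewrite !Mcst// (lt_le_trans r10).
  by move: r12; rewrite le_eqVlt => /predU1P[->//|r12]; rewrite ltW// Mlt.
have cvg0 : gaussian_mean p alpha f r @[r --> 0^'+] --> (modulus (f 0) `^ p)%:E.
  have : (M r)%:E @[r --> 0^'+] --> (modulus (f 0) `^ p)%:E.
    by apply: cvg_EFin; [exact: nearW|exact: (cvg_disc_mean cg g0 gturn cu u0 um)].
  apply: cvg_trans; apply: near_eq_cvg; near=> r; rewrite ME//.
have cvgoo : cvg (gaussian_mean p alpha f r @[r --> +oo%R]).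
  have : cvg ((M (Num.max r 1))%:E @[r --> +oo%R]).
    apply: nondecreasing_is_cvge => r1 r2 r12; rewrite lee_fin; apply: Mle.
      by rewrite lt_max ltr01 orbT.
    by rewrite ge_max !le_max r12 lexx orbT.
  move=> /cvg_ex[l Ml]; apply/cvg_ex; exists l; move: Ml; apply: cvg_trans.
  apply: near_eq_cvg; near=> r.
  have r1 : 1 <= r by near: r; exact: nbhs_pinfty_ge.
  by rewrite ME ?(lt_le_trans ltr01)// max_l.
have E0 : gaussian_mean_at0 p alpha f = (modulus (f 0) `^ p)%:E by exact: cvg_lim cvg0.
have M0le r : 0 < r -> modulus (f 0) `^ p <= M r.
  by move=> r0; have /andP[] := disc_mean_bounds cg g0 gturn cu u0 um r0.
have Mleoo r : 0 < r -> ((M r)%:E <= gaussian_mean_at_infty p alpha f)%E.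
  move=> r0; apply: lime_ge => //; near=> s.
  have rs : r <= s by near: s; apply: nbhs_pinfty_ge; rewrite num_real.
  by rewrite ME ?(lt_le_trans r0)// lee_fin Mle.
split; first by move=> ncf r1 r2 r10 r12;
  rewrite (ME r1)// (ME r2) ?(lt_trans r10)// lte_fin; exact: Mlt.
split; first by apply/cvg_ex; exists (modulus (f 0) `^ p)%:E.
split; first exact: cvgoo.
split; first by rewrite E0.
move=> r r0; rewrite ME// E0; split; first by rewrite lee_fin M0le.
split; first exact: Mleoo.
have r20 : 0 < r / 2 by rewrite divr_gt0.
have r2r : r / 2 < r by lra.
split; split.
- move=> [E]; apply: contrapT => ncf; have := Mlt ncf _ _ r20 r2r.
  by rewrite -E ltNge M0le.
- by move=> cf; rewrite Mcst.
- move=> E; apply: contrapT => ncf.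
  have rr : r < r + 1 by rewrite ltrDl.
  have r10 := lt_trans r0 rr.
  have := Mlt ncf _ _ r0 rr.
  by rewrite -lte_fin E ltNge Mleoo.
- move=> cf; apply/esym; apply: cvg_lim => //.
  apply: (@cvg_trans _ (cst (M r)%:E s @[s --> +oo%R])); last exact: cvg_cst.
  apply: near_eq_cvg; near=> s.
  have s0 : 0 < s by near: s; exact: nbhs_pinfty_gt.
  by rewrite /= ME// !Mcst.
Unshelve. all: by end_near. Qed.
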